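(* Let $C$ be an elliptic curve over $\mathbb{F}_q$, i.e. a smooth, projective, geometrically connected curve of genus $1$ over $\mathbb{F}_q$ with an $\mathbb{F}_q$-rational point $\infty$. Then the multiple zeta values associated with $C$ are non-zero: for every $r\ge 1$ and all positive integers $s_1,\dots,s_r$, the multiple zeta value $\zeta_A(s_1,\dots,s_r)\in k_\infty$ is non-zero.
   Context: Let $q$ be a power of a prime $p$. For a smooth, projective, geometrically connected curve $C$ over $\mathbb{F}_q$ with an $\mathbb{F}_q$-rational point $\infty$, let $k$ be the function field of $C$ over $\mathbb{F}_q$, let $A\subset k$ be the ring of rational functions on $C$ regular away from $\infty$, and let $k_\infty$ be the completion of $k$ at $\infty$. For $a\in A\setminus\{0\}$, its degree $\deg a\ge 0$ is the order of its pole at $\infty$. Sign and monic elements: fix a sign function $k^\times\to\mathbb{F}_q^\times$, that is, a homomorphism of multiplicative groups which is the identity map on $\mathbb{F}_q^\times\subset k^\times$. An element $a\in A\setminus\{0\}$ is called monic if its sign is $1$. Multiple zeta values: for positive integers $s_1,\dots,s_r$, $$\zeta_A(s_1,\dots,s_r):=\sum_{\substack{a_1,\dots,a_r\in A\text{ monic}\\ \deg a_1>\cdots>\deg a_r\ge 0}}\frac{1}{a_1^{s_1}\cdots a_r^{s_r}}\in k_\infty .$$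
   Formalization: The sign function is also required to be continuous for the ∞-adic topology (i.e. the restriction of a homomorphism on k_∞^×); for arbitrary homomorphisms on k^× the claim fails, e.g. ζ_A(1,1)=0 is possible for y²=x³−x−1 over F_3. *)

(* Defs.v *)
From HB Require Import structures.
From mathcomp Require Import all_boot all_order all_algebra finmap.
From mathcomp Require Import boolp classical_sets.

Set Implicit Arguments.
Unset Strict Implicit.
Unset Printing Implicit Defensive.

Import Order.TTheory GRing.Theory Num.Theory.
Local Open Scope ring_scope.

(* Curves are handled through the classical dictionary between smooth,
   projective, geometrically connected curves C over the finite field F and
   function fields k / F of one variable with full constant field F; closed
   points of C are the places of k / F.  The field k is an extension of F
   through iota : {rmorphism F -> k}. *)

(* Normalized discrete valuations.  The true value at 0 is +oo; the junk
   convention v 0 = 0 makes a valuation determined by its values on k^*, so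
   that equality of valuations is equality of functions.  Inequalities must
   therefore go through val_ge, which treats 0 as having valuation +oo. *)
Definition is_valuation (k : fieldType) (v : k -> int) : Prop :=
  [/\ v 0 = 0,
      forall x y, x != 0 -> y != 0 -> v (x * y) = v x + v y,
      forall x y, x != 0 -> y != 0 -> x + y != 0 ->
        Num.min (v x) (v y) <= v (x + y)
    & exists t, v t = 1].

Definition val_ge (k : fieldType) (v : k -> int) (n : int) (x : k) : Prop :=
  x = 0 \/ n <= v x.

Record place (F : finFieldType) (k : fieldType) (iota : {rmorphism F -> k}) :=
  Place {
    pval :> k -> int;
    pval_valuation : is_valuation pval;
    pval_const : forall c : F, c != 0 -> pval (iota c) = 0
  }.

HB.instance Definition _ (F : finFieldType) (k : fieldType)
  (iota : {rmorphism F -> k}) := gen_eqMixin (place iota).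
HB.instance Definition _ (F : finFieldType) (k : fieldType)
  (iota : {rmorphism F -> k}) := gen_choiceMixin (place iota).

(* k is a finite extension of F(x) for some x transcendental over F, and F is
   algebraically closed in k.  Since F is perfect, the latter is geometric
   connectedness of the curve. *)
Definition is_function_field (F : finFieldType) (k : fieldType)
    (iota : {rmorphism F -> k}) : Prop :=
  (exists x : k, ~ algebraicOver iota x /\
     exists (n : nat) (b : 'I_n -> k), forall y : k,
       exists f g : 'I_n -> {poly F},
         (forall i, g i != 0) /\
         y = \sum_(i < n)
               (map_poly iota (f i)).[x] / (map_poly iota (g i)).[x] * b i) /\
  (forall y : k, algebraicOver iota y -> exists c : F, y = iota c).

(* For F-subspaces U of W of k: the quotient W / U has a basis of n elements. *)
Definition has_dim (F : finFieldType) (k : fieldType)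
    (iota : {rmorphism F -> k}) (W U : set k) (n : nat) : Prop :=
  exists b : 'I_n -> k, (forall i, W (b i)) /\
    forall y, W y ->
      exists! c : {ffun 'I_n -> F}, U (y - \sum_(i < n) iota (c i) * b i).

(* dim_F (W / U); equal to 0 when W / U is infinite-dimensional, which does
   not happen below for function fields. *)
Definition qdim (F : finFieldType) (k : fieldType)
    (iota : {rmorphism F -> k}) (W U : set k) : nat :=
  xget 0%N [set n | has_dim iota W U n]%classic.

(* The degree of the residue field of P over F. *)
Definition place_degree (F : finFieldType) (k : fieldType)
    (iota : {rmorphism F -> k}) (P : place iota) : nat :=
  qdim iota (val_ge P 0) (val_ge P 1).

Definition divisor (F : finFieldType) (k : fieldType)
    (iota : {rmorphism F -> k}) := {fsfun place iota -> int with 0}.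

Definition div_degree (F : finFieldType) (k : fieldType)
    (iota : {rmorphism F -> k}) (D : divisor iota) : int :=
  \sum_(P <- finsupp D) D P * (place_degree P)%:Z.

Definition RR_space (F : finFieldType) (k : fieldType)
    (iota : {rmorphism F -> k}) (D : divisor iota) : set k :=
  [set f | forall P : place iota, val_ge P (- D P) f]%classic.

Definition ell (F : finFieldType) (k : fieldType)
    (iota : {rmorphism F -> k}) (D : divisor iota) : nat :=
  qdim iota (RR_space D) [set 0]%classic.

(* The genus is the maximum of deg D - l(D) + 1 over all divisors D. *)
Definition has_genus (F : finFieldType) (k : fieldType)
    (iota : {rmorphism F -> k}) (g : nat) : Prop :=
  (forall D : divisor iota, div_degree D - (ell D)%:Z + 1 <= g%:Z) /\
  (exists D : divisor iota, div_degree D - (ell D)%:Z + 1 = g%:Z).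

Definition regular_away (F : finFieldType) (k : fieldType)
    (iota : {rmorphism F -> k}) (oo : place iota) : set k :=
  [set a | forall P : place iota, P <> oo -> val_ge P 0 a]%classic.

Definition pole_order (F : finFieldType) (k : fieldType)
    (iota : {rmorphism F -> k}) (oo : place iota) (a : k) : int := - oo a.

(* Sign functions, given by their values on k^*; sgn 0 is irrelevant.  As
   usual a sign function is the restriction to k^* of a homomorphism from
   (k_oo)^* to F^*; for a character of k^* this means continuity for the
   oo-adic topology (and amounts to triviality on 1-units), which is the last
   condition.  A character of the abstract group k^* need not satisfy it, and
   multiple zeta values can vanish for such characters: k^* / F^* is free
   abelian, so that signs of principal primes could be chosen at will. *)
Definition is_sign (F : finFieldType) (k : fieldType)
    (iota : {rmorphism F -> k}) (oo : place iota) (sgn : k -> F) : Prop :=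
  [/\ forall x, x != 0 -> sgn x != 0,
      forall x y, x != 0 -> y != 0 -> sgn (x * y) = sgn x * sgn y,
      forall c : F, c != 0 -> sgn (iota c) = c
    & exists n : int, forall x, x != 0 -> val_ge oo n (x - 1) -> sgn x = 1].

Definition is_monic (F : finFieldType) (k : fieldType)
    (iota : {rmorphism F -> k}) (oo : place iota) (sgn : k -> F) (a : k) :
    Prop :=
  [/\ regular_away oo a, a != 0 & sgn a = 1].

(* (K, w) is the completion of (k, v) through j. *)
Definition is_completion (k K : fieldType) (v : k -> int)
    (j : {rmorphism k -> K}) (w : K -> int) : Prop :=
  [/\ is_valuation w,
      forall x, w (j x) = v x,
      forall (y : K) (n : int), exists x : k, val_ge w n (y - j x)
    & forall u : nat -> K,
        (forall n : int, exists N : nat, forall i l : nat,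
           (N <= i)%N -> (N <= l)%N -> val_ge w n (u i - u l)) ->
        exists y : K, forall n : int, exists N : nat, forall i : nat,
          (N <= i)%N -> val_ge w n (u i - y)].

(* Unconditional summation, for the topology defined by w, of the family f
   indexed by the elements of I. *)
Definition has_sum (T : choiceType) (K : fieldType) (w : K -> int)
    (I : set T) (f : T -> K) (z : K) : Prop :=
  forall n : int, exists S0 : {fset T},
    (forall a, a \in S0 -> I a) /\
    forall S : {fset T}, (forall a, a \in S -> I a) -> (S0 `<=` S)%fset ->
      val_ge w n (\sum_(a <- S) f a - z).

Definition mzv_index (F : finFieldType) (k : fieldType)
    (iota : {rmorphism F -> k}) (oo : place iota) (sgn : k -> F) (r : nat) :
    set {ffun 'I_r -> k} :=
  [set a | [/\ forall i, is_monic oo sgn (a i),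
               forall i l : 'I_r, (i < l)%N ->
                 pole_order oo (a l) < pole_order oo (a i)
             & forall i, 0 <= pole_order oo (a i)]]%classic.

Definition mzv_term (k K : fieldType) (j : {rmorphism k -> K}) (r : nat)
    (s : 'I_r -> nat) (a : {ffun 'I_r -> k}) : K :=
  (\prod_(i < r) j (a i) ^+ s i)^-1.

(* The default value is 0, so a nonzero value is genuinely the sum of the
   series. *)
Definition mzv (F : finFieldType) (k K : fieldType)
    (iota : {rmorphism F -> k}) (oo : place iota) (sgn : k -> F)
    (j : {rmorphism k -> K}) (w : K -> int) (r : nat) (s : 'I_r -> nat) : K :=
  xget 0 [set z | has_sum w (mzv_index oo sgn (r := r)) (mzv_term j s) z]%classic.

(* Main.v *)
(* The monic elements of A of the D-th possible degree w_D are the sums of x_D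
   and of an F-linear combination of x_0, ..., x_(D-1), where x_i is monic of
   degree w_i.  Let S_D(s) be the sum of their -s-th powers.  If v(S_D(s))
   strictly increases with D for every s > 0, then among the products
   S_(d_1)(s_1) ... S_(d_r)(s_r), d_1 > ... > d_r, whose sum is the multiple
   zeta value, the one with d_i = r - i has a valuation smaller than all
   others, and the sum is not zero.

   To compute v(S_D(s)), replace the -s-th powers by (p^N - s)-th powers with N
   large: a^(p^N) is close to x_D^(p^N).  By Lucas' theorem and the vanishing
   of the sums of c^k over c in F, the terms of the expanded power sum that
   survive are indexed by the chains 0 < M_0 < ... < M_(D-1) of multiples of
   q - 1, each digitwise (in base p) below the next, the last one having no
   carry when added to s - 1; the term of such a chain has valuation
   s w_D + sum_i (w_(i+1) - w_i) M_i.  As in Sheats' work on the polynomial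
   ring, the chain of minimal weight is unique; this determines v(S_D(s)), and
   dropping the last element of a chain shows that it increases with D.  Genus
   1 enters through Riemann's inequality alone: there is at most one gap in the
   degrees, so w_1 - w_0 <= 2 and w_(i+1) - w_i = 1 for i > 0.

   Multiples of q - 1 are studied through their carries.  Let q = p^e, and let
   u x be the sum of the digits of M in the positions congruent to x modulo e.
   Then q - 1 divides M iff u x = p t (S x) - t x for some t, where S is the
   cyclic successor.  A minimal M takes its digits in each class from the
   lowest available positions, so that it is encoded by t. *)
Require Import Defs.
From mathcomp Require Import all_boot all_order all_algebra.
From mathcomp Require Import all_field finmap zify ring lra.
From mathcomp Require Import boolp classical_sets.

Set Implicit Arguments.
Unset Strict Implicit.
Unset Printing Implicit Defensive.

(** * Carry vectors *)

Lemma ex_argmin (A : Type) (P : A -> Prop) (m : A -> nat) :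
  (exists x, P x) -> exists2 x, P x & forall y, P y -> m x <= m y.
Proof.
move=> [x0 Px0]; have [n le_n] := ubnP (m x0); elim: n => // n IHn in x0 Px0 le_n *.
case: (pselect (exists2 y, P y & m y < m x0)) => [[y Py lt_y]|no].
  by apply: (IHn y Py); lia.
exists x0 => // y Py; rewrite leqNgt; apply/negP=> lt_y; apply: no.
by exists y.
Qed.

Section Carries.

Variables (I : finType) (S : I -> I) (p : nat).
Hypothesis p_gt1 : 1 < p.
Hypothesis S_trans : forall x y : I, exists k, iter k S x = y.

Definition usage (t : I -> nat) (x : I) := p * t (S x) - t x.

(** Makes the truncated subtraction in [usage] exact, so that [t] is the carry vector of the digit
    counts [usage t]. *)
Definition feasible (t : I -> nat) := forall x, t x <= p * t (S x).

(** A zero at [S x] forces one at [x], and every orbit of [S] meets [v]. *)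
Lemma feasible_eq0 t v : feasible t -> t v = 0 -> forall x, t x = 0.
Proof.
move=> ft tv x; have [k Ek] := S_trans x v.
elim: k x Ek => [x /= ->//|k IHk x]; rewrite iterSr => /IHk tSx.
by have := ft x; rewrite tSx; lia.
Qed.

(** Take a solution of least total. Where the constraint at [x] is slack and [k x > l x], [k x] can
    be lowered by one, since it enters the other constraints only on the smaller side. *)
Lemma least_solution (l B b r : I -> nat) :
  (forall x, l x <= B x) -> (forall x, p * B (S x) + r x <= b x + B x) ->
  exists k : I -> nat,
    [/\ forall x, l x <= k x, forall x, k x <= B x,
        forall x, p * k (S x) + r x <= b x + k x
      & forall x, k x = l x \/ p * k (S x) + r x = b x + k x].
Proof.
move=> lB hB.
pose P k := [/\ forall x : I, l x <= k x, forall x, k x <= B x &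
   forall x, p * k (S x) + r x <= b x + k x].
have [k [lk kB hk] kmin] := @ex_argmin _ P (fun k => \sum_x k x)
  (ex_intro _ B (And3 lB (fun x => leqnn _) hB)).
exists k; split=> // x; have := lk x; rewrite leq_eqVlt => /predU1P[->|ltx]; first by left.
right; apply/eqP; rewrite eqn_leq hk leqNgt /=; apply/negP=> slack.
pose k' y := if y == x then (k x).-1 else k y.
have k'le y : k' y <= k y by rewrite /k'; case: eqP => // ->; lia.
have Pk' : P k'.
  split=> y; first by rewrite /k'; case: eqP => [->|_] //; lia.
    exact: leq_trans (k'le y) (kB y).
  have h : p * k' (S y) <= p * k (S y) by rewrite leq_mul2l k'le orbT.
  have := hk y; rewrite [k' y]/k'; case: eqP => [ey|_]; last by lia.
  by subst y; lia.
have := kmin k' Pk'; rewrite (bigD1 x) //= [X in _ <= X](bigD1 x) //= {1}/k' eqxx.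
have -> : \sum_(i | i != x) k' i = \sum_(i | i != x) k i.
  by apply: eq_bigr => y /negPf; rewrite /k' => ->.
by lia.
Qed.

(** Among the strictly increasing families within the capacities, one of least total automatically
    has nested usages; candidate chains thus need only be checked against capacities. *)
Lemma nesting D (r cap : nat -> I -> nat) :
  (forall i x, i < D -> p * r i (S x) <= cap i x + r i x) ->
  (forall i x, i.+1 < D -> r i x < r i.+1 x) ->
  (forall x, 0 < D -> 0 < r 0 x) ->
  (forall i x, i.+1 < D -> cap i x <= cap i.+1 x) ->
  exists t : nat -> I -> nat,
    [/\ forall i, i < D -> feasible (t i),
        forall i x, i.+1 < D -> t i x < t i.+1 x,
        forall x, 0 < D -> 0 < t 0 x,
        forall i x, i.+1 < D -> usage (t i) x <= usage (t i.+1) x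
      & forall i x, i < D -> usage (t i) x <= cap i x].
Proof.
move=> hcap hinc hpos hmon.
pose P (t : nat -> I -> nat) := [/\
  forall i x, i < D -> p * t i (S x) <= cap i x + t i x,
  forall i x, i.+1 < D -> t i x < t i.+1 x & forall x, 0 < D -> 0 < t 0 x].
pose prev (t : nat -> I -> nat) i x := if i is i'.+1 then t i' x else 0.
have [t [tcap tinc tpos] tmin] := @ex_argmin _ P
  (fun t => \sum_(i < D) \sum_x t i x) (ex_intro _ r (And3 hcap hinc hpos)).
have prevlt i x : i < D -> prev t i x < t i x.
  by case: i => [|i] iD /=; [apply: tpos | apply: tinc].
have prevcap i x : i < D -> p * prev t i (S x) <= cap i x + prev t i x.
  case: i => [|i] iD /=; first by rewrite muln0.
  by have := tcap i x (ltnW iD); have := hmon i x iD; lia.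
(* Otherwise [t i x] could be lowered by one, against the minimality of [t]. *)
have key i x : i < D -> t i x + p * prev t i (S x) <= p * t i (S x) + prev t i x.
  move=> iD; rewrite leqNgt; apply/negP=> viol.
  have neq : S x != x.
    apply/eqP=> Sx; rewrite Sx in viol; have := prevlt i x iD.
    have : (p - 1) * prev t i x <= (p - 1) * t i x.
      by rewrite leq_mul2l (ltnW (prevlt i x iD)) orbT.
    rewrite !mulnBl !mul1n.
    by have := @leq_pmull (t i x) p; have := @leq_pmull (prev t i x) p; lia.
  pose t' j y := if (j == i) && (y == x) then (t i x).-1 else t j y.
  have t'le j y : t' j y <= t j y.
    by rewrite /t'; case: ifP => [/andP[/eqP-> /eqP->]|]//; lia.
  have big : prev t i x + p <= (t i x).-1.
    have := prevlt i (S x) iD => lt.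
    have : p * (prev t i (S x)).+1 <= p * t i (S x) by rewrite leq_mul2l lt orbT.
    by rewrite mulnS; lia.
  have Pt' : P t'.
    split=> [j y jD|j y jD|y D0].
    - have h : p * t' j (S y) <= p * t j (S y) by rewrite leq_mul2l t'le orbT.
      have := tcap j y jD; rewrite [t' j y]/t'; case: ifP; last by lia.
      case/andP=> /eqP ej /eqP ey; subst j y.
      have := prevcap i x iD; rewrite /t' (negPf neq) andbF; lia.
    - have := tinc j y jD; have := t'le j y; rewrite [t' j.+1 y]/t'.
      case: ifP => [/andP[/eqP ej /eqP ey]|_]; last by lia.
      by subst y; rewrite -ej in big *; rewrite /= in big; lia.
    - have := tpos y D0; rewrite /t'; case: ifP => // /andP[/eqP e0 /eqP ey].
      by subst i y; lia.
  have := tmin t' Pt'; rewrite leqNgt => /negP; apply.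
  rewrite (bigD1 (Ordinal iD)) //= [X in _ < X](bigD1 (Ordinal iD)) //=.
  rewrite -addSn leq_add //; last by apply: leq_sum => j _; apply: leq_sum.
  rewrite (bigD1 x) //= [X in _ < X](bigD1 x) //= -addSn leq_add //.
    by rewrite /t' !eqxx /=; lia.
  by apply: leq_sum.
exists t; split=> //.
- elim=> [|i IHi] iD x; first by have := key 0 x iD; rewrite /= muln0; lia.
  have := key i.+1 x iD; have := IHi (ltnW iD) x => /=; lia.
- by move=> i x iD; have := key i.+1 x iD; rewrite /usage /=; lia.
- by move=> i x iD; have := tcap i x iD; rewrite /usage; lia.
Qed.

(* Signs of [p * h (S x) - h x] tell which classes gain units and which lose
   some when [h] is subtracted from a vector.  The least [k] that gains the
   first unit at [z] is split off from [h] until it is one that frees a unit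
   of [c]. *)
Lemma extraction (h : I -> nat) v c :
  h v = 0 -> h c < p * h (S c) ->
  exists z (k : I -> nat), [/\ p * h (S z) < h z,
     forall x, k x <= h x, p * k (S z) + 1 = k z,
     forall x, x != z -> k x <= p * k (S x) <= k x + (p * h (S x) - h x)
   & k c < p * k (S c)].
Proof.
have [n le_n] := ubnP (\sum_x h x); elim: n => // n IHn in h le_n * => hv hc.
(* Without such a [z] the vector [h] is feasible and vanishes at [v], hence everywhere, against
   [hc]. *)
have [z hz] : exists z, p * h (S z) < h z.
  apply/existsP; rewrite -[[exists _, _]]negbK negb_exists; apply/negP=> /forallP nz.
  have fh : feasible h by move=> x; have := nz x; lia.
  by have := feasible_eq0 fh hv (S c); lia.
pose b x := p * h (S x) - h x; pose r x := (x == z) : nat.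
have [|x|k [_ kh hk ktight]] := @least_solution (fun=> 0) h b r; first by [].
  rewrite /r /b; case: eqP => [->|_] /=; lia.
have bz : b z = 0 by rewrite /b; lia.
have kz : p * k (S z) + 1 = k z.
  by have := ktight z; have := hk z; rewrite /r eqxx bz /=; lia.
have kx x : x != z -> k x <= p * k (S x) <= k x + (p * h (S x) - h x).
  move=> /negPf nz; have := ktight x; have := hk x; rewrite /r nz /b; lia.
have [kc|kc] := ltnP (k c) (p * k (S c)); first by exists z, k; split.
have cz : c != z by apply: contraTneq hc => ->; lia.
pose h' x := h x - k x.
have Sub x : p * h' (S x) = p * h (S x) - p * k (S x) by rewrite /h' mulnBr.
have lep x : p * k (S x) <= p * h (S x) by rewrite leq_mul2l kh orbT.
have [|||z' [k' [hz' k'h k'z k'x k'c]]] := IHn h'.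
- rewrite -ltnS; apply: leq_trans le_n; rewrite ltnS.
  rewrite (bigD1 z) //= [X in _ < X](bigD1 z) //= -addSn leq_add //.
    by rewrite /h'; have := kh z; lia.
  by apply: leq_sum => x _; rewrite /h' leq_subr.
- by rewrite /h'; lia.
- by rewrite Sub /h'; have := kx c cz; have := kh c; have := lep c; lia.
exists z', k'; split=> //.
- have [->//|neq] := eqVneq z' z.
  by move: hz'; rewrite Sub /h'; have := kx z' neq; have := kh z'; have := lep z'; lia.
- by move=> x; apply: leq_trans (k'h x) _; rewrite /h' leq_subr.
move=> x nx; have := k'x x nx; rewrite Sub /h' => /andP[-> /= le1].
have [ex|neq] := eqVneq x z.
  by subst x; have := kh z; have := lep z; lia.
by have := kx x neq; have := kh x; have := lep x; lia.
Qed.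

End Carries.

(** * Chains of least cost *)

Section Slots.

Variables (I : finType) (S : I -> I) (p e : nat) (s : I -> nat -> nat).
Hypothesis p_gt1 : 1 < p.
Hypothesis e_gt0 : 0 < e.
Hypothesis e_gt1 : forall x y : I, x != y -> 1 < e.
Hypothesis S_trans : forall x y : I, exists k, iter k S x = y.

(* [s x k] is the position of the [k]-th available unit of class [x], so that
   [u x] units of each class [x] are worth at least [value u]. *)
Definition load (x : I) (n : nat) := \sum_(k < n) p ^ s x k.
Definition value (u : I -> nat) := \sum_x load x (u x).

(** Modelled on base [p]: a position holds at most [p - 1] units, positions of one class lie [e]
    apart, and units all placed below [h] form a number less than [p ^ h]. *)
Hypothesis s_mono : forall x k l, k <= l -> s x k <= s x l.
Hypothesis s_neq : forall x y k l, x != y -> s x k != s y l.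
Hypothesis s_shift : forall x k, s x k + e <= s x (k + p.-1).
Hypothesis s_bound : forall (u : I -> nat) h,
  (forall x k, k < u x -> s x k < h) -> value u < p ^ h.

Local Notation us := (usage S p).
Local Notation feas := (feasible S p).

Let p_gt0 : 0 < p. Proof. by lia. Qed.
Let pX_gt0 h : 0 < p ^ h. Proof. by rewrite expn_gt0 p_gt0. Qed.

Lemma loadS x n : load x n.+1 = load x n + p ^ s x n.
Proof. by rewrite /load big_ord_recr. Qed.

Lemma load_mono x m n : m <= n -> load x m <= load x n.
Proof.
move=> /subnKC <-; elim: (n - m) => [|d IHd]; first by rewrite addn0.
by rewrite addnS loadS (leq_trans IHd) ?leq_addr.
Qed.

Lemma load_drop x m n : m < n -> load x m + p ^ s x n.-1 <= load x n.
Proof.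
by case: n => // n; rewrite ltnS loadS leq_add2r => /(load_mono x).
Qed.

Lemma s_shiftn x k j : s x k + e * j <= s x (k + j * p.-1).
Proof.
elim: j => [|j IHj]; first by rewrite muln0 mul0n !addn0.
have -> : k + j.+1 * p.-1 = k + j * p.-1 + p.-1 by lia.
by have := s_shift x (k + j * p.-1); rewrite mulnS; lia.
Qed.

(** Match each remaining unit with the one [j * p.-1] places later in its class, which lies at least
    [e * j] positions higher. *)
Lemma load_shift x n j : load x (n - j * p.-1) * p ^ (e * j) <= load x n.
Proof.
have [le_n|/ltnW lt_n] := leqP n (j * p.-1).
  by rewrite (eqP le_n) /load big_ord0.
rewrite -{2}(subnK lt_n); elim: (n - _) => [|d IHd]; first by rewrite /load big_ord0.
rewrite loadS mulnDl addSn loadS leq_add // -expnD leq_exp2l //.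
exact: s_shiftn.
Qed.

(** Only classes with [u x < u' x] contribute, and there the whole initial segment up to [u' x] lies
    below [h]; [s_bound] applies to these segments. *)
Lemma window_bound (u u' : I -> nat) h :
  (forall x k, u x <= k < u' x -> s x k < h) ->
  \sum_x (load x (u' x) - load x (u x)) < p ^ h.
Proof.
move=> hs; pose w x := if u x < u' x then u' x else 0.
apply: (@leq_ltn_trans (value w)).
  apply: leq_sum => x _; rewrite /w; case: ltnP => [_|/(load_mono x)]; first exact: leq_subr.
  by rewrite -subn_eq0 => /eqP->.
apply: s_bound => x k; rewrite /w; case: (ltnP (u x)) => // lt_u lt_k.
apply: (@leq_ltn_trans (s x (u' x).-1)); first by apply: s_mono; lia.
by apply: hs; lia.
Qed.

(** All units gained lie below the top unit lost in class [c], so together they are worth less than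
    that unit. *)
Lemma value_lt (u u' : I -> nat) c :
  u' c < u c ->
  (forall x k, u x <= k < u' x -> s x k < s c (u c).-1) ->
  value u' < value u.
Proof.
move=> uc hs; have lt := window_bound hs; have dc := load_drop c uc.
suff : value u' + p ^ s c (u c).-1
   <= value u + \sum_x (load x (u' x) - load x (u x)) by lia.
rewrite /value -big_split /= (bigD1 c) //= [X in _ <= X](bigD1 c) //=.
have : \sum_(i | i != c) load i (u' i) <=
  \sum_(i | i != c) (load i (u i) + (load i (u' i) - load i (u i))).
  by apply: leq_sum => x _; lia.
by lia.
Qed.

Lemma top_difference (u u' : I -> nat) : (exists x, u x != u' x) ->
  exists2 c, u c != u' c & forall x k, x != c ->
    minn (u x) (u' x) <= k < maxn (u x) (u' x) ->
    s x k < s c (maxn (u c) (u' c)).-1.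
Proof.
move=> [x0 Px0]; pose F x := s x (maxn (u x) (u' x)).-1.
case: (@arg_maxnP _ x0 (fun x => u x != u' x) F Px0) => c Pc cmax.
exists c => // x k neq hk; rewrite ltn_neqAle s_neq //=.
apply: (@leq_trans (F x)); first by apply: s_mono; lia.
by apply: cmax; apply/eqP; lia.
Qed.

(** The highest slot at which two vectors differ decides which value is larger. *)
Lemma value_inj (u u' : I -> nat) : value u = value u' -> u =1 u'.
Proof.
move=> Eu x; apply/eqP; apply/negP=> /negP neq.
have [c] := @top_difference u u' (ex_intro _ x neq).
wlog lt : u u' Eu neq / u' c < u c => [H nc hs|_ hs].
  case: (ltngtP (u' c) (u c)) => [lt|lt|Ec]; first exact: (H u u').
    apply: (H u' u) => //; rewrite 1?eq_sym // => y k yc.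
    by rewrite minnC maxnC (maxnC (u' c)); exact: hs.
  by rewrite Ec eqxx in nc.
have : value u' < value u; last by rewrite Eu ltnn.
apply: (@value_lt _ _ c) => // y k hk.
have yc : y != c by apply: contraTneq hk => ->; lia.
by have := hs y k yc; rewrite (_ : maxn (u c) (u' c) = u c); [apply; lia | lia].
Qed.

Variable delta : nat -> nat.
Hypothesis delta0 : delta 0 <= 2.
Hypothesis deltaS : forall i, delta i.+1 <= 1.
Hypothesis delta_gt0 : forall i, 0 < delta i.

(** The carry form of a chain of multiples of [q - 1]: nested usages stand for the digitwise order.
    The bound [cap] on the last level passes down by nesting. *)
Definition chain D (cap : I -> nat) (t : nat -> I -> nat) :=
  [/\ forall i, i < D -> feas (t i),
      forall i x, i.+1 < D -> t i x < t i.+1 x,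
      forall x, 0 < D -> 0 < t 0 x,
      forall i x, i.+1 < D -> us (t i) x <= us (t i.+1) x
    & forall x, 0 < D -> us (t D.-1) x <= cap x].

Definition cost D (t : nat -> I -> nat) := \sum_(i < D) delta i * value (us (t i)).

(** The sum of [delta i * 2 ^ i] is at most [2 + 2 + 4 + ... + 2 ^ (n - 1) = 2 ^ n]; a first weight
    of 2, that is one gap in the degrees, is just affordable. *)
Lemma weighted_sum n (F : nat -> nat) M :
  (forall i, i < n -> F i * 2 ^ (n - i) <= M) -> \sum_(i < n) delta i * F i <= M.
Proof.
move=> hF; rewrite -(leq_pmul2r (expn_gt0 2 n)) big_distrl /=.
have h2 : \sum_(i < n) delta i * 2 ^ i <= 2 ^ n.
  case: n {hF} => [|n]; first by rewrite big_ord0.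
  elim: n => [|n IHn]; first by rewrite big_ord_recr big_ord0 /= expn0 muln1 expn1.
  rewrite big_ord_recr /= [2 ^ n.+2]expnS mul2n -addnn leq_add //.
  by rewrite -[X in _ <= X]mul1n leq_mul2r deltaS orbT.
apply: (@leq_trans (\sum_(i < n) M * (delta i * 2 ^ i))).
  apply: leq_sum => i _; rewrite mulnCA -!mulnA leq_mul2l; apply/orP; right.
  have -> : 2 ^ n = 2 ^ (n - i) * 2 ^ i by rewrite -expnD subnK // ltnW.
  by rewrite mulnA leq_mul2r hF ?orbT.
by rewrite -big_distrr leq_mul2l h2 orbT.
Qed.

(** * Exchange arguments for a fixed chain *)

Section Chain.

Variables (n : nat) (cap : I -> nat) (t : nat -> I -> nat).
Hypothesis tP : chain n.+1 cap t.

Lemma chain_gap i j x : i + j < n.+1 -> t i x + j <= t (i + j) x.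
Proof.
have [_ tinc _ _ _] := tP.
elim: j => [|j IHj] ij; first by rewrite !addn0.
by rewrite addnS in ij *; have := IHj (ltnW ij); have := tinc _ x ij; lia.
Qed.

Lemma chain_level i x : i < n.+1 -> i < t i x.
Proof.
by have [_ _ /(_ x) t0 _ _] := tP => lt_i; have := @chain_gap 0 i x lt_i; rewrite add0n; lia.
Qed.

Lemma chain_usage i j x : i + j < n.+1 -> us (t i) x <= us (t (i + j)) x.
Proof.
have [_ _ _ tus _] := tP.
elim: j => [|j IHj] ij; first by rewrite !addn0.
by rewrite addnS in ij *; have := IHj (ltnW ij); have := tus _ x ij; lia.
Qed.

Lemma usageE i x : i < n.+1 -> p * t i (S x) = us (t i) x + t i x.
Proof. by have [tf _ _ _ _] := tP => /tf /(_ x); rewrite /usage => ?; lia. Qed.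

Lemma value_gt0 (u : I -> nat) x : 0 < u x -> 0 < value u.
Proof.
move=> ux; rewrite /value (bigD1 x) //=.
have : load x 1 <= load x (u x) by exact: load_mono.
by rewrite loadS /load big_ord0; have := pX_gt0 (s x 0); lia.
Qed.

(** If no unit were used, going round from [x] back to [x] would multiply the positive number
    [t i x] by a power of [p]. *)
Lemma chain_value_gt0 (x : I) i : i < n.+1 -> 0 < value (us (t i)).
Proof.
move=> lt_i; rewrite lt0n; apply/negP=> /eqP v0.
have us0 y : us (t i) y = 0.
  by apply/eqP; rewrite -leqn0 leqNgt; apply/negP=> /value_gt0; rewrite v0.
have step k y : t i y = p ^ k * t i (iter k S y).
  elim: k y => [|k IHk] y; first by rewrite expn0 mul1n.
  by rewrite iterSr expnS -mulnA -IHk usageE ?us0.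
have [k Ek] := S_trans (S x) x.
have := step k.+1 x; rewrite iterSr Ek => Ex.
have := chain_level x lt_i.
have : 1 < p ^ k.+1 by rewrite expnS; have := pX_gt0 k; nia.
by nia.
Qed.

(** Otherwise lower the top vector by one everywhere, and by one more for each level below; the
    resulting chain costs in all at most the value of the old top level. *)
Lemma optimal_level (x0 : I) :
  (forall t', chain n.+1 cap t' -> cost n.+1 t <= cost n.+1 t') ->
  exists v, t n v = n.+1.
Proof.
move=> topt; apply: contrapT => neq.
have lev x : n.+1 < t n x.
  rewrite ltn_neqAle (@chain_level n x (leqnn _)) andbT.
  by apply/eqP=> Ex; apply: neq; exists x.
(* Subtracting [j] everywhere from a carry vector lowers each usage by [j * p.-1]. *)
pose r i x := t n x - (n.+1 - i); pose cp i x := us (t n) x - (n.+1 - i) * p.-1.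
have [||||t' [t'f t'inc t'pos t'us t'cap]] := @nesting I S p p_gt1 n.+1 r cp.
- move=> i x lt_i; have := @usageE n x (leqnn _); have := lev x; have := lev (S x).
  rewrite /r /cp; set j := n.+1 - i => h1 h2 h3.
  have jn : j <= n.+1 by rewrite /j leq_subr.
  have -> : p * (t n (S x) - j) = us (t n) x + t n x - p * j by rewrite mulnBr h3.
  have -> : j * p.-1 = p * j - j by rewrite -subn1 mulnBr muln1 mulnC.
  by have := @leq_pmull j p p_gt0; lia.
- by move=> i x lt_i; rewrite /r; have := lev x; lia.
- by move=> x _; rewrite /r; have := lev x; lia.
- by move=> i x lt_i; rewrite /cp leq_sub2l // leq_mul2r; apply/orP; right; lia.
have t'C : chain n.+1 cap t'.
  split=> // x _; have [_ _ _ _ tc] := tP.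
  apply: leq_trans (tc x isT); rewrite /=; apply: leq_trans (t'cap n x _) _ => //.
  exact: leq_subr.
have half i : i < n.+1 -> value (us (t' i)) * 2 ^ (n.+1 - i) <= value (us (t n)).
  move=> lt_i; rewrite /value big_distrl /=.
  apply: leq_sum => x _; apply: leq_trans (load_shift x _ (n.+1 - i)).
  apply: leq_mul; first by apply: load_mono; exact: t'cap.
  apply: (@leq_trans (p ^ (n.+1 - i))); first by rewrite leq_exp2r //; lia.
  by rewrite leq_exp2l //; exact: leq_pmull.
have := topt _ t'C; rewrite leqNgt => /negP; apply.
have vn := chain_value_gt0 x0 (leqnn n.+1); have v0 := chain_value_gt0 x0 (ltn0Sn n).
(* With a single level of weight 1 the bound by the old top value is not strict, so the halving is
   used directly. *)
move: half vn v0; rewrite /cost; case: (n) => [|m] half vn v0.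
  rewrite !big_ord_recl !big_ord0 !addn0 ltn_pmul2l //.
  by have := half 0 isT; rewrite subn0 expn1 /=; lia.
apply: leq_ltn_trans (weighted_sum half) _.
rewrite big_ord_recr big_ord_recl /=.
have : 0 < delta 0 * value (us (t 0)) by rewrite muln_gt0 delta_gt0.
by have := leq_pmull (value (us (t m.+1))) (delta_gt0 m.+1); lia.
Qed.

(** The least increment [k] towards [g] that takes one unit from [c] is added to the levels that use
    as much of [c] as the top one; there the unit lost outweighs all units gained. *)
Lemma exchange_one (g : I -> nat) c :
  feas g -> (forall x, us g x <= cap x) ->
  t n c < g c -> us g c < us (t n) c ->
  (forall x k, us (t n) x <= k < us g x -> s x k < s c (us (t n) c).-1) ->
  exists2 t', chain n.+1 cap t' & cost n.+1 t' < cost n.+1 t.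
Proof.
move=> gf gcap gc uc hs.
have gE x : p * g (S x) = us g x + g x by have := gf x; rewrite /usage => ?; lia.
have tE x : p * t n (S x) = us (t n) x + t n x by exact: usageE.
pose h x := g x - t n x; pose b x := us g x - us (t n) x; pose r x := (x == c) : nat.
have [|x|k [_ kh hk ktight]] := @least_solution I S p p_gt1 (fun=> 0) h b r; first by [].
  rewrite /h /b /r mulnBr gE tE; have [->|_] := eqVneq x c; lia.
have kc : k c = p * k (S c) + 1.
  have := hk c; have := ktight c; rewrite /r eqxx /= /b; lia.
have kx x : x != c -> k x <= p * k (S x) <= k x + b x.
  by move=> /negPf nc; have := hk x; have := ktight x; rewrite /r nc /=; lia.
(* Levels below [i0] use strictly less of [c], so they remain nested under the modified ones. *)
have [i0 /eqP i0E i0min] : exists2 i, us (t i) c == us (t n) c &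
    forall i', us (t i') c == us (t n) c -> i <= i'.
  have ex : exists i, us (t i) c == us (t n) c by exists n.
  by exists (ex_minn ex); case: ex_minnP.
have i0n : i0 <= n by apply: i0min.
have top i : i0 <= i -> i <= n -> us (t i) c = us (t n) c.
  move=> i0i iN; apply/eqP; rewrite eqn_leq.
  have := @chain_usage i (n - i) c; have := @chain_usage i0 (i - i0) c.
  by rewrite !subnKC // i0E => -> // ->.
pose t' i x := if i0 <= i then t i x + k x else t i x.
have usE i x : i0 <= i -> i <= n -> us (t' i) x + k x = us (t i) x + p * k (S x).
  move=> i0i iN; have tiE := @usageE i x iN.
  rewrite /t' i0i {1}/usage mulnDr tiE; have [Ex|/kx] := eqVneq x c; last by lia.
  by rewrite Ex in tiE *; rewrite kc; have := top i i0i iN; lia.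
have usE' i x : i < i0 -> us (t' i) x = us (t i) x.
  by move=> lti; rewrite /t' leqNgt lti.
have [tf tinc tpos tus tcap] := tP.
have t'P : chain n.+1 cap t'.
  split=> [i iN x|i x iN|x _|i x iN|x _].
  - rewrite /t'; case: ifP => i0i; last exact: tf.
    rewrite mulnDr (@usageE i x iN); have [->|/kx] := eqVneq x c; last by lia.
    by rewrite kc; have := top i i0i iN; lia.
  - by rewrite /t'; have := tinc i x iN; case: ifP => h1; case: ifP => h2; lia.
  - by rewrite /t'; have := tpos x isT; case: ifP; lia.
  - have [h1|h1] := leqP i0 i.
      have := usE i x h1 (ltnW iN); have := usE i.+1 x (leqW h1) iN.
      by have := tus i x iN; lia.
    rewrite (usE' i x h1); have := tus i x iN.
    have [h2|h2] := leqP i0 i.+1; last by rewrite (usE' i.+1 x).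
    have := usE i.+1 x h2 iN; have [->|/kx] := eqVneq x c; last by lia.
    have : us (t i) c != us (t n) c by apply: contraTneq h1 => /eqP/i0min; lia.
    by have := top i.+1 h2 iN; rewrite kc; lia.
  - rewrite /=; have := usE n x i0n (leqnn n); have := tcap x isT; have := gcap x.
    have [->|/kx] := eqVneq x c; first by rewrite kc /=; lia.
    by rewrite /b /=; lia.
exists t' => //.
have better i : i0 <= i -> i <= n -> value (us (t' i)) < value (us (t i)).
  move=> i0i iN; apply: (@value_lt _ _ c).
    by have := usE i c i0i iN; rewrite kc; have := top i i0i iN; lia.
  move=> x j hj; rewrite (top i i0i iN).
  have le1 : us (t i) x <= us (t n) x.
    by have := @chain_usage i (n - i) x; rewrite subnKC // => ->.
  (* Shifting the index by the difference of usages raises the slot and moves the window at level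
     [i] into the one at the top, where [hs] applies. *)
  apply: (@leq_ltn_trans (s x (j + (us (t n) x - us (t i) x)))).
    by apply: s_mono; exact: leq_addr.
  apply: hs; have := usE i x i0i iN; move: hj; have [->|/kx] := eqVneq x c.
    by rewrite kc; lia.
  by rewrite /b; lia.
rewrite /cost big_ord_recr [X in _ < X]big_ord_recr /= -addnS leq_add //.
  apply: leq_sum => i _; rewrite leq_mul2l; apply/orP; right.
  have [h1|h1] := leqP i0 i; first by apply: ltnW; apply: better => //; apply: ltnW.
  by apply: leq_sum => x _; rewrite usE'.
by rewrite ltn_pmul2l // better.
Qed.

(** * Exchange when the minimal top vector [g] does not exceed [t n] at [c] *)

Section Descent.

Variables (g : I -> nat) (c v : I).
Hypothesis g_level : forall x, n < g x.
Hypothesis gcap : forall x, us g x <= cap x.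
Hypothesis gmin : forall z, feas z -> (forall x, n < z x) ->
  (forall x, us z x <= cap x) -> value (us g) <= value (us z).
Hypothesis gc : g c <= t n c.
Hypothesis uc : us g c < us (t n) c.
Hypothesis tv : t n v = n.+1.

Local Notation u := (us (t n)).
Local Notation a := (s c (u c).-1).

Hypothesis hs : forall x k, x != c ->
  minn (u x) (us g x) <= k < maxn (u x) (us g x) -> s x k < a.

Let uE x : p * t n (S x) = u x + t n x.
Proof. exact: usageE. Qed.

Let ucap x : u x <= cap x.
Proof. by have [_ _ _ _ /(_ x isT)] := tP. Qed.

(* The classes in which the top set has units beyond the first place where
   it differs from the set given by [g]. *)
Definition high x := (0 < u x) && (a < s x (u x).-1).

Lemma high_neq x : high x -> x != c.
Proof. by apply: contraTneq => ->; rewrite /high ltnn andbF. Qed.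

(** A difference in a high class would occur at a slot above [a], which [hs] excludes. *)
Lemma high_eq x : high x -> us g x = u x.
Proof.
move=> hx; have xc := high_neq hx; case/andP: hx => u0 hx.
case: (ltngtP (us g x) (u x)) => // lt.
  have : s x (u x).-1 < a.
    have le : us g x <= (u x).-1 by rewrite -ltnS prednK.
    by apply: hs => //; rewrite geq_min le orbT leq_max prednK // leqnn.
  by rewrite ltnNge ltnW.
have : s x (u x) < a by apply: hs => //; rewrite geq_minl leq_max lt orbT.
by rewrite ltnNge (leq_trans (ltnW hx)) // s_mono // leq_pred.
Qed.

Lemma low_slot x k : ~~ high x -> k < u x -> s x k <= a.
Proof.
rewrite negb_and -leqNgt -leqNgt => /orP[|h ku]; first by lia.
by apply: leq_trans h; apply: s_mono; lia.
Qed.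

(** Otherwise [w] would beat [g]: it loses a unit above [a], while its gains over [us g] lie at [a]
    or below. *)
Lemma high_rigid z w x : feas w -> (forall y, n < w y) ->
  u z < us g z -> z != c -> (forall y, us w y <= u y + (y == z)) ->
  high x -> u x <= us w x.
Proof.
move=> wf wl hz zc wu hx; rewrite leqNgt; apply/negP=> lt.
have wcap y : us w y <= cap y.
  have := wu y; have := ucap y; have [->|_] := eqVneq y z; last by rewrite addn0; lia.
  by have := gcap z; rewrite /=; lia.
have := gmin wf wl wcap; rewrite leqNgt => /negP; apply.
have Ex := high_eq hx; apply: (@value_lt _ _ x); first by rewrite Ex.
move=> y k hk; rewrite Ex; have [hy|hy] := boolP (high y).
  have yz : y != z by apply: contraTneq hz => <-; rewrite high_eq // ltnn.
  by have := wu y; rewrite (negPf yz) -(high_eq hy); lia.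
case/andP: hx => _ hx; apply: leq_ltn_trans hx.
have [ky|ky] := ltnP k (u y); first exact: low_slot.
have := wu y; have [Ey|_] := eqVneq y z; last by rewrite addn0; lia.
by rewrite /= => h; apply: ltnW; apply: hs; rewrite ?Ey //; subst y; lia.
Qed.

Variables (z : I) (k : I -> nat).
Hypothesis zc : z != c.
Hypothesis hz : u z < us g z.
Hypothesis kh : forall x, k x <= t n x - g x.
Hypothesis kz : p * k (S z) + 1 = k z.
Hypothesis kx : forall x, x != z -> k x <= p * k (S x) <= k x + (u x - us g x).
Hypothesis kc : k c < p * k (S c).

Let w x := t n x - k x.

Let kt x : k x <= t n x.
Proof. by have := kh x; lia. Qed.

Lemma usage_reduced x : us w x + p * k (S x) = u x + k x.
Proof.
rewrite {1}/usage /w mulnBr uE; have := kt x; have := kt (S x) => h1 h2.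
have : p * k (S x) <= p * t n (S x) by rewrite leq_mul2l h1 orbT.
rewrite uE; have [->|/kx] := eqVneq x z; last by lia.
by have := kt z; rewrite -kz; lia.
Qed.

Lemma reduced_feasible : feas w.
Proof.
move=> x; rewrite /w mulnBr uE; have := kt x.
by have [->|/kx] := eqVneq x z; rewrite -?kz; lia.
Qed.

Lemma reduced_level x : n < w x.
Proof. by rewrite /w; have := kh x; have := g_level x; have := @chain_level n x (leqnn _); lia. Qed.

Lemma reduced_usage x : us w x <= u x + (x == z).
Proof.
have := usage_reduced x; have [->|/kx] := eqVneq x z; rewrite -?kz /=; lia.
Qed.

Lemma high_neqz x : high x -> x != z.
Proof. by move=> /high_eq Ex; apply: contraTneq hz => <-; rewrite Ex ltnn. Qed.

Lemma kv : k v = 0.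
Proof. by have := kh v; rewrite tv; have := g_level v; lia. Qed.

(** If [k x > 0], restore to [w] a least [m <= k] with [m x > 0]. Rigidity at [x] makes [m]
    feasible, and [m v <= k v = 0] then forces [m = 0]. *)
Lemma high_k x : high x -> k x = 0 /\ k (S x) = 0.
Proof.
move=> hx; have xz := high_neqz hx; have Ex := high_eq hx.
have kxx : k x = p * k (S x) by have := kx xz; rewrite Ex subnn; lia.
suff kx0 : k x = 0 by split=> //; move: kxx; rewrite kx0; lia.
apply/eqP; rewrite -leqn0 leqNgt; apply/negP=> kx1.
pose b y := p * k (S y) - k y.
have [||m [lm mk hm mt]] := @least_solution I S p p_gt1 (fun y => y == x) k b (fun=> 0).
- by move=> y; case: eqP => [->|_].
- by move=> y; rewrite /b; lia.
pose w' y := w y + m y.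
have w'E y : us w' y + m y = us w y + p * m (S y).
  rewrite /usage /w' mulnDr; have := reduced_feasible y; have := usage_reduced y.
  have := mt y; have := hm y; rewrite /b; have [->|_] := eqVneq y x; last by lia.
  have : 0 < u x by case/andP: hx.
  by have := reduced_usage x; rewrite (negPf xz) /usage; lia.
have w'f : feas w'.
  move=> y; have := w'E y; have := reduced_feasible y; rewrite /w' mulnDr.
  have := mt y; have := hm y; rewrite /b; have [->|_] := eqVneq y x; last by lia.
  have : 0 < u x by case/andP: hx.
  by have := usage_reduced x; rewrite /usage; lia.
have w'l y : n < w' y by rewrite /w'; have := reduced_level y; lia.
have w'u y : us w' y <= u y + (y == z).
  have := w'E y; have := hm y; have := usage_reduced y; rewrite /b.
  by have [->|/kx] := eqVneq y z; rewrite -?kz /=; lia.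
have mf : feas m.
  move=> y; have [->|ny] := eqVneq y x.
    have := high_rigid w'f w'l hz zc w'u hx.
    by have := w'E x; have := usage_reduced x; lia.
  have := mt y; have := hm y; rewrite (negPf ny) /b; lia.
have := feasible_eq0 p_gt1 S_trans mf (v := v) _ x; have := mk v; rewrite kv.
by have := lm x; rewrite eqxx /= => ? ? /(_ ltac:(lia)); lia.
Qed.

(** Otherwise lower [w] by a least [m] that is positive along the path: a unit is gained at most at
    the end of the path, where there is room for it, while the high class [x] loses one, against
    [high_rigid]. *)
Lemma path_rigid x j : high x ->
  (forall i, i <= j -> n.+1 < w (iter i S (S x))) ->
  u (iter j S (S x)) <= us w (iter j S (S x)).
Proof.
move=> hx slack; set y0 := iter j S (S x); rewrite leqNgt; apply/negP=> lt.
pose l y := [exists i : 'I_j.+1, y == iter i S (S x)] : nat.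
have lP i : i <= j -> l (iter i S (S x)) = 1.
  by move=> ij; rewrite /l; case: existsP => // -[]; exists (Ordinal (ij : i < j.+1)).
have wE y : p * w (S y) = us w y + w y.
  by have := reduced_feasible y; rewrite /usage => ?; lia.
have wl := reduced_level.
have [||m [lm mw hm mt]] :=
  @least_solution I S p p_gt1 l (fun y => w y - n.+1) (us w) (fun=> 0).
- move=> y; rewrite /l; case: existsP => [[i /eqP->]|_] //=.
  by have := slack i; have := ltn_ord i => ij /(_ ij); lia.
- move=> y; rewrite mulnBr wE; have := wl y; have := leq_pmull n.+1 p_gt0.
  by lia.
pose w' y := w y - m y.
have w'E y : us w' y + p * m (S y) = us w y + m y.
  rewrite {1}/usage /w' mulnBr wE; have := hm y; have := mw y.
  have : p * m (S y) <= p * w (S y) by rewrite leq_mul2l; have := mw (S y); lia.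
  by rewrite wE; lia.
have w'f : feas w'.
  move=> y; rewrite /w' mulnBr wE; have := hm y; have := mw y; lia.
have w'l y : n < w' y by rewrite /w'; have := mw y; have := wl y; lia.
have mle y : m y <= p * m (S y) + (y == y0).
  have [my|my] := mt y; last by lia.
  rewrite my /l; case: existsP => //= -[i /eqP Ey].
  have [Ei|/eqP ni] := eqVneq (i : nat) j; first by rewrite Ey Ei eqxx; lia.
  have ij : i.+1 <= j by have := ltn_ord i; lia.
  have := lm (S y); rewrite Ey -iterS (lP _ ij); nia.
have y0z : y0 != z by apply: contraTneq lt => ->; have := usage_reduced z; rewrite -kz; lia.
have w'u y : us w' y <= u y + (y == z).
  have := w'E y; have := mle y; have := reduced_usage y.
  have [Ey|_] := eqVneq y y0; last by lia.
  by subst y; rewrite (negPf y0z); lia.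
have := high_rigid w'f w'l hz zc w'u hx.
have [kx0 kSx0] := high_k hx.
have := w'E x; have := usage_reduced x; rewrite kx0 kSx0.
have : 0 < u x by case/andP: hx.
have mS : 0 < m (S x) by have := lm (S x); rewrite (lP 0).
have [mx|mx] := mt x; last by lia.
have : m x <= 1 by rewrite mx /l; case: existsP.
by have := leq_pmulr p mS; lia.
Qed.

(* The chain below the new top set [us w] is obtained by lowering [w] by one
   from level to level, but must not exceed [t] at the vertices that follow a
   high class along vertices where there is room for this. *)
Let reach y := exists x j, [/\ high x, y = iter j S (S x) &
   forall i, i < j -> n.+1 < w (iter i S (S x))].

Let r i y := if pselect (reach y) then minn (w y - (n - i)) (t i y)
             else w y - (n - i).

Let room i x := us w x - (n - i) * p.-1.

(** High classes keep their old usage as a bound at each level, so their expensive units are not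
    multiplied; the others may also use the room left by lowering [w]. *)
Let lid i x := if high x then us (t i) x
               else minn (us w x) (maxn (us (t i) x) (room i x)).

Lemma lowered_chain : exists2 t', chain n.+1 cap t' &
  forall i x, i < n.+1 -> us (t' i) x <= lid i x.
Proof.
have wE y : p * w (S y) = us w y + w y.
  by have := reduced_feasible y; rewrite /usage => ?; lia.
have wl := reduced_level.
have roomE i x : i < n.+1 -> p * (w (S x) - (n - i)) <= room i x + (w x - (n - i)).
  move=> lt_i; rewrite mulnBr wE /room; set j := n - i.
  have jn : j <= n by rewrite /j leq_subr.
  have -> : j * p.-1 = p * j - j by rewrite -subn1 mulnBr muln1 mulnC.
  by have := wl x; have := leq_pmull j p_gt0; lia.
have lidle i x : i < n.+1 -> room i x <= us w x -> ~~ high x ->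
   room i x <= lid i x.
  by move=> lt_i le /negPf nh; rewrite /lid nh; lia.
have tn i x : i < n.+1 -> t i x + (n - i) <= t n x.
  by move=> lt_i; have := @chain_gap i (n - i) x; rewrite subnKC //; apply.
have tun i x : i < n.+1 -> us (t i) x <= u x.
  by move=> lt_i; have := @chain_usage i (n - i) x; rewrite subnKC //; apply.
have [tf tinc tpos tus tcap] := tP.
have [||||t' [t'f t'inc t'pos t'us t'cap]] := @nesting I S p p_gt1 n.+1 r lid.
- move=> i x lt_i; have tiE := @usageE i x lt_i.
  have rle y : r i y <= w y - (n - i) by rewrite /r; case: pselect => ? /=; lia.
  have prle : p * r i (S x) <= p * (w (S x) - (n - i)) by rewrite leq_mul2l rle orbT.
  have [hx|hx] := boolP (high x).
    have [kx0 kSx0] := high_k hx.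
    have rS : r i (S x) <= t i (S x).
      rewrite /r; case: pselect => [?|[]] /=; first exact: geq_minr.
      by exists x, 0.
    have rx : t i x <= r i x.
      have : t i x <= w x - (n - i) by have := tn i x lt_i; rewrite /w kx0; lia.
      by rewrite /r; case: pselect => ? /=; lia.
    have : p * r i (S x) <= p * t i (S x) by rewrite leq_mul2l rS orbT.
    by rewrite tiE /lid hx; lia.
  have := roomE i x lt_i; have := lidle i x lt_i (leq_subr _ _) hx.
  rewrite [r i x]/r; case: (pselect (reach x)) => [rx|?] /=; last by lia.
  have [le|lt] := leqP (w x - (n - i)) (t i x); first by lia.
  move=> _ _.
  (* The bound [t i x] is active, so the path continues through [x] and the bound applies at [S x]
     as well; [path_rigid] then leaves room for the old usage. *)
  have wx : n.+1 < w x by have := @chain_level i x lt_i; have := wl x; lia.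
  have [y [j [hy Ex hj]]] := rx.
  have hj' i' : i' <= j -> n.+1 < w (iter i' S (S y)).
    by rewrite leq_eqVlt => /predU1P[->|/hj//]; rewrite -Ex.
  have rS : r i (S x) <= t i (S x).
    rewrite /r; case: pselect => [?|[]] /=; first exact: geq_minr.
    exists y, j.+1; split=> //=; first by rewrite Ex.
  have := path_rigid hy hj'; rewrite -Ex => ux.
  have : p * r i (S x) <= p * t i (S x) by rewrite leq_mul2l rS orbT.
  by have := tun i x lt_i; rewrite tiE /lid (negPf hx); lia.
- move=> i x lt_i; have := tinc i x lt_i; have := wl x.
  by rewrite /r; case: pselect => ? /=; lia.
- move=> x _; have := tpos x isT; have := wl x.
  by rewrite /r; case: pselect => ? /=; lia.
- move=> i x lt_i; have := tus i x lt_i; rewrite /lid; case: ifP => // _.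
  have : room i x <= room i.+1 x.
    by rewrite /room leq_sub2l // leq_mul2r; apply/orP; right; lia.
  by lia.
exists t' => //; split=> // x _; have := t'cap n x (leqnn _).
rewrite /= /lid; case: ifP => [_|_]; first by have := ucap x; lia.
have := reduced_usage x; have := ucap x; have [->|_] := eqVneq x z => /=; last by lia.
by have := gcap z; lia.
Qed.

Let low_value := \sum_x (if high x then 0 else load x (us w x)).

Lemma new_slot : s z (u z) < a.
Proof. by apply: hs => //; rewrite geq_minl leq_max hz orbT. Qed.

Lemma low_reduced_slot x j : ~~ high x -> j < us w x -> s x j <= a.
Proof.
move=> hx hj; have [lt|le] := ltnP j (u x); first exact: low_slot.
have := reduced_usage x; have [Ex|_] := eqVneq x z => /= h; last by lia.
by apply: ltnW; apply: leq_ltn_trans new_slot; rewrite Ex; apply: s_mono; subst x; lia.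
Qed.

Lemma reduced_drop : us w c < u c.
Proof. by have := usage_reduced c; lia. Qed.

(** As [c] has lost a unit, its next slot is at [a] or below. If at [a], one more unit of [c]
    supplies the term [p ^ a]; if below, all units counted lie below [a]. *)
Lemma low_value_bound : low_value + p ^ a < p ^ a.+1.
Proof.
pose lw x := if high x then 0 else us w x.
have lwE : low_value = value lw.
  by apply: eq_bigr => x _; rewrite /lw; case: ifP => // _; rewrite /load big_ord0.
have hc : ~~ high c by apply/negP=> /high_neq; rewrite eqxx.
have lwc : lw c = us w c by rewrite /lw (negPf hc).
have lws x j : j < lw x -> s x j <= a.
  by rewrite /lw; case: ifP => // /negbT hx; exact: low_reduced_slot.
have := @low_slot c (us w c) hc reduced_drop; rewrite leq_eqVlt => /predU1P[Ea|lt].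
  pose lw' x := lw x + (x == c).
  have -> : low_value + p ^ a = value lw'.
    rewrite lwE /value (bigD1 c) //= [in RHS](bigD1 c) //= /lw' eqxx addn1 loadS.
    rewrite lwc Ea [LHS]addnAC; congr (_ + _).
    by apply: eq_bigr => x /negPf->; rewrite addn0.
  apply: s_bound => x j; rewrite /lw'; have [->|_] := eqVneq x c.
    rewrite addn1 ltnS => hj; rewrite ltnS -Ea; apply: s_mono.
    by rewrite -lwc.
  by rewrite addn0 => /lws.
have : value lw < p ^ a.
  apply: s_bound => x j hj; have [Ex|nx] := eqVneq x c.
    apply: leq_ltn_trans lt; rewrite Ex; apply: s_mono.
    by rewrite -lwc -Ex ltnW.
  by rewrite ltn_neqAle s_neq //= lws.
by rewrite lwE expnS; have := pX_gt0 a; nia.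
Qed.

(** Class [c] loses at least its unit at [a], class [z] gains the single unit at [s z (u z)], and no
    other class gains. *)
Lemma top_drop : value (us w) + p ^ a <= value u + p ^ s z (u z).
Proof.
rewrite /value (bigD1 c) //= [X in _ <= X + _](bigD1 c) //=.
have := load_drop c reduced_drop.
suff : \sum_(i | i != c) load i (us w i)
  <= \sum_(i | i != c) load i (u i) + p ^ s z (u z) by lia.
rewrite (bigD1 z) //= [X in _ <= X + _](bigD1 z) //=.
have wz : us w z = (u z).+1 by have := usage_reduced z; rewrite -kz; lia.
rewrite wz loadS addnAC leq_add2r leq_add2l; apply: leq_sum => x /andP[_ /negPf xz].
by apply: load_mono; have := reduced_usage x; rewrite xz addn0.
Qed.

(** The top drops by at least [p ^ a - p ^ s z (u z)]. The levels below rise in all by the sum of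
    [delta i * m i] at most, which is smaller: two distinct classes force [e >= 2], so [m i] shrinks
    by a factor [2 * p] per level. *)
Lemma exchange_many : exists2 t', chain n.+1 cap t' & cost n.+1 t' < cost n.+1 t.
Proof.
have [t' t'P t'lid] := lowered_chain; exists t' => //.
pose m i := \sum_x (if high x then 0 else load x (room i x)).
have low i : i < n.+1 -> value (us (t' i)) <= value (us (t i)) + m i.
  move=> lt_i; rewrite /value /m -big_split /=; apply: leq_sum => x _.
  apply: leq_trans (load_mono x (t'lid i x lt_i)) _; rewrite /lid.
  case: ifP => _; first by rewrite addn0.
  apply: (@leq_trans (load x (maxn (us (t i) x) (room i x)))).
    by apply: load_mono; exact: geq_minr.
  by rewrite /maxn; case: ifP => _; [exact: leq_addl | exact: leq_addr].
have topv : value (us (t' n)) <= value (us w).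
  apply: leq_sum => x _; apply: load_mono; apply: leq_trans (t'lid n x (leqnn _)) _.
  rewrite /lid; case: ifP => [hx|_]; last exact: geq_minl.
  by have [kx0 kSx0] := high_k hx; have := usage_reduced x; rewrite kx0 kSx0; lia.
have mbound i : i < n -> m i * p ^ (e * (n - i)) <= low_value.
  move=> lt_i; rewrite /m big_distrl /=; apply: leq_sum => x _.
  by case: ifP => // _; exact: load_shift.
have pe : 2 * p <= p ^ e.
  rewrite -(subnKC (e_gt1 zc)) expnD; have := pX_gt0 (e - 2).
  have : 2 * p <= p ^ 2 by rewrite expnS expn1 leq_mul2r p_gt1 orbT.
  by nia.
have W : (\sum_(i < n) delta i * m i) * p <= low_value.
  rewrite big_distrl /=.
  under eq_bigr => i _ do rewrite -mulnA.
  apply: (@weighted_sum n (fun i => m i * p)) => i lt_i.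
  apply: leq_trans (mbound i lt_i); rewrite -mulnA leq_mul2l; apply/orP; right.
  have -> : n - i = (n - i).-1.+1 by lia.
  move: (n - i).-1 => d; rewrite mulnS expnD expnS mulnA (mulnC p) leq_mul //.
  apply: (@leq_trans (p ^ d)); first by case: d => // d; rewrite leq_exp2r.
  by rewrite leq_exp2l // leq_pmull.
have lvb := low_value_bound; have td := top_drop; have ns := new_slot.
have pb : p ^ s z (u z) * p <= p ^ a by rewrite mulnC -expnS leq_exp2l.
have Wlt : \sum_(i < n) delta i * m i + p ^ s z (u z) < p ^ a.
  by rewrite -(ltn_pmul2r p_gt0) mulnDl; rewrite expnS mulnC in lvb; lia.
rewrite /cost big_ord_recr [X in _ < X]big_ord_recr /=.
have : \sum_(i < n) delta i * value (us (t' i)) <=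
   \sum_(i < n) delta i * value (us (t i)) + \sum_(i < n) delta i * m i.
  rewrite -big_split /=; apply: leq_sum => i _; rewrite -mulnDr leq_mul2l.
  by rewrite low ?orbT // ltnS ltnW.
have : delta n * value (us (t' n)) + (p ^ a - p ^ s z (u z)) <= delta n * value u.
  have : value (us (t' n)) + (p ^ a - p ^ s z (u z)) <= value u by lia.
  rewrite -(leq_pmul2l (delta_gt0 n)) mulnDr.
  by have := leq_pmull (p ^ a - p ^ s z (u z)) (delta_gt0 n); lia.
move: Wlt; clear.
move: (\sum_(i < n) delta i * value (us (t' i))) (\sum_(i < n) delta i * value (us (t i))).
by move: (\sum_(i < n) delta i * m i) (delta n * _) (delta n * _) (p ^ a) (p ^ _); lia.
Qed.

End Descent.

(** Look at the highest slot, in class [c], where the usages differ. If [t n c < g c], move towards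
    [g]; otherwise extract a correction from [t n - g], which vanishes at the vertex given by
    [optimal_level]. *)
Lemma optimal_top (g : I -> nat) :
  (forall t', chain n.+1 cap t' -> cost n.+1 t <= cost n.+1 t') ->
  feas g -> (forall x, n < g x) -> (forall x, us g x <= cap x) ->
  (forall z, feas z -> (forall x, n < z x) -> (forall x, us z x <= cap x) ->
     value (us g) <= value (us z)) ->
  us (t n) =1 us g.
Proof.
move=> topt gf gl gcap gmin; apply: value_inj; apply/eqP; rewrite eqn_leq.
have [tf _ _ _ tcap] := tP.
apply/andP; split; last first.
  by apply: gmin => [|x|x]; [exact: tf | exact: chain_level | exact: tcap].
rewrite leqNgt; apply/negP=> lt.
have nex : ~ exists2 t', chain n.+1 cap t' & cost n.+1 t' < cost n.+1 t.
  by move=> [t' /topt]; rewrite leqNgt => /negP.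
have dif : exists x, us (t n) x != us g x.
  apply: contrapT => h; move: lt; rewrite ltnNge => /negP; apply.
  apply: leq_sum => x _; apply: load_mono; rewrite leq_eqVlt; apply/orP; left.
  by apply: contra_notT h => ?; exists x.
have [c nc hs] := top_difference dif.
have uc : us g c < us (t n) c.
  case: (ltngtP (us g c) (us (t n) c)) nc => // lt' _.
  move: lt; rewrite ltnNge => /negP[]; apply: ltnW; apply: (@value_lt _ _ c) => // x k hk.
  have xc : x != c by apply: contraTneq hk => ->; lia.
  by have := hs x k xc; rewrite (maxn_idPr (ltnW lt')); apply; lia.
have Ec : maxn (us (t n) c) (us g c) = us (t n) c by lia.
rewrite {}Ec in hs.
have [gc|gc] := ltnP (t n c) (g c).
  apply: nex; apply: (exchange_one gf gcap gc uc) => x k hk.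
  have xc : x != c by apply: contraTneq hk => ->; lia.
  by apply: hs => //; lia.
have [v tv] := optimal_level c topt.
have gE x : p * g (S x) = us g x + g x by have := gf x; rewrite /usage => ?; lia.
have uE x : p * t n (S x) = us (t n) x + t n x by exact: usageE.
pose h x := t n x - g x.
have hE x : p * h (S x) = us (t n) x + t n x - (us g x + g x).
  by rewrite /h mulnBr gE uE.
have [||z [k [hz kh kz kx kc]]] := @extraction I S p p_gt1 S_trans h v c.
- by rewrite /h tv; have := gl v; lia.
- by rewrite hE /h; lia.
have hz' : us (t n) z < us g z by move: hz; rewrite hE /h; lia.
apply: nex; apply: (@exchange_many g c v gl gcap gmin gc uc tv hs z k) => //.
  by apply: contraTneq hz' => ->; lia.
by move=> x xz; have := kx x xz; rewrite hE /h; lia.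
Qed.

End Chain.

(** Induction from the top, whose usage is that of [g]. The rest is optimal for the capacity [us g],
    because an optimal shorter chain can always be extended by [g]. *)
Theorem optimal_chain_unique D cap (t t' : nat -> I -> nat) (x0 : I) :
  chain D cap t -> (forall y, chain D cap y -> cost D t <= cost D y) ->
  chain D cap t' -> (forall y, chain D cap y -> cost D t' <= cost D y) ->
  forall i, i < D -> us (t i) =1 us (t' i).
Proof.
elim: D cap => [|n IHn] cap //= tP topt t'P t'opt.
pose P (g : I -> nat) := [/\ feas g, forall x, n < g x & forall x, us g x <= cap x].
have Pt : P (t n).
  by have [tf _ _ _ tcap] := tP; split=> [|x|x]; [exact: tf | exact: (chain_level tP) | exact: tcap].
have [g [gf gl gcap] gmin] := @ex_argmin _ P (fun g => value (us g)) (ex_intro _ _ Pt).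
have gmin' z : feas z -> (forall x, n < z x) -> (forall x, us z x <= cap x) ->
   value (us g) <= value (us z) by move=> *; apply: gmin; split.
have Et := optimal_top tP topt gf gl gcap gmin'.
have Et' := optimal_top t'P t'opt gf gl gcap gmin'.
case: n => [|n] in IHn tP topt t'P t'opt P Pt gl gmin gmin' Et Et' *.
  by case=> // _ x; rewrite Et Et'.
have sub y : chain n.+2 cap y -> us (y n.+1) =1 us g -> chain n.+1 (us g) y.
  move=> [yf yinc ypos yus ycap] Ey; split=> // [i lt_i|i x lt_i|i x lt_i|x _].
  - by apply: yf; apply: ltnW.
  - by apply: yinc; apply: ltnW.
  - by apply: yus; apply: ltnW.
  - by rewrite -Ey; exact: yus.
have opt y : chain n.+2 cap y -> (forall z, chain n.+2 cap z -> cost n.+2 y <= cost n.+2 z) ->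
   us (y n.+1) =1 us g -> forall z, chain n.+1 (us g) z -> cost n.+1 y <= cost n.+1 z.
  move=> yP yopt Ey.
  suff H z : chain n.+1 (us g) z ->
      (forall z', chain n.+1 (us g) z' -> cost n.+1 z <= cost n.+1 z') ->
      cost n.+1 y <= cost n.+1 z.
    have [z zP zopt] := @ex_argmin _ (chain n.+1 (us g)) (cost n.+1)
       (ex_intro _ y (sub y yP Ey)).
    by move=> z' /zopt; apply: leq_trans; apply: H zP zopt.
  move=> zP zopt; have [v zv] := optimal_level zP x0 zopt.
  have [zf zinc zpos zus zcap] := zP.
  pose y' i := if i == n.+1 then g else z i.
  (* Starting from [z n v = n.+1 < g v], the strict inequality propagates along [S]. *)
  have zg x : z n x < g x.
    have [k <-] := S_trans v x; elim: k => [|k IHk] /=; first by rewrite zv.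
    rewrite -(ltn_pmul2l p_gt0) (usageE zP) // -addnS.
    move: (iter k S v) IHk => x1 ltzg.
    have := zcap x1 isT; have := gf x1; rewrite /= {2}/usage; lia.
  have y'P : chain n.+2 cap y'.
    split=> [i|i x|x _|i x|x _]; rewrite /y' ?eqxx //.
    - by case: eqP => // /eqP ni lt_i; apply: zf; lia.
    - move=> lt_i; rewrite eqSS; have [->|ni] := eqVneq i n.
        by rewrite ltn_eqF //; exact: zg.
      by rewrite ltn_eqF //; apply: zinc; lia.
    - exact: zpos.
    - move=> lt_i; rewrite eqSS; have [->|ni] := eqVneq i n.
        by rewrite ltn_eqF //; exact: zcap.
      by rewrite ltn_eqF //; apply: zus; lia.
  have := yopt _ y'P; rewrite /cost big_ord_recr [X in _ <= X]big_ord_recr /=.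
  have -> : value (us (y n.+1)) = value (us g) by apply: eq_bigr => x _; rewrite Ey.
  rewrite /y' eqxx leq_add2r; congr (_ <= _); apply: eq_bigr => i _.
  by rewrite ltn_eqF.
move=> i; rewrite ltnS leq_eqVlt => /predU1P[-> x|lt_i]; first by rewrite Et Et'.
by apply: (IHn (us g)) => //; [apply: sub|apply: opt|apply: sub|apply: opt].
Qed.

End Slots.

(** * Chains of numbers *)

Section Digits.

Variable p : nat.
Hypothesis p_gt1 : 1 < p.

Definition digit (m j : nat) := (m %/ p ^ j) %% p.

Definition digit_le (k m : nat) := forall j, digit k j <= digit m j.

Let p_gt0 : 0 < p. Proof. by lia. Qed.

Lemma digit_lt m j : digit m j < p.
Proof. by rewrite ltn_mod. Qed.

Lemma modn_digit m J : m %% p ^ J.+1 = m %% p ^ J + digit m J * p ^ J.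
Proof.
rewrite /digit modn_divl -expnS addnC {1}(divn_eq (m %% p ^ J.+1) (p ^ J)).
by rewrite modn_dvdm // dvdn_exp2l.
Qed.

Lemma digits_sum m J : m < p ^ J -> m = \sum_(j < J) digit m j * p ^ j.
Proof.
move=> /modn_small {1}<-; elim: J => [|J IHJ]; first by rewrite modn1 big_ord0.
by rewrite modn_digit IHJ big_ord_recr.
Qed.

Lemma sum_digits_lt (d : nat -> nat) J : (forall j, j < J -> d j < p) ->
  \sum_(j < J) d j * p ^ j < p ^ J.
Proof.
elim: J => [|J IHJ] hd; first by rewrite big_ord0.
have -> : p ^ J.+1 = p ^ J + p.-1 * p ^ J by rewrite expnS -{1}(prednK p_gt0) mulSn.
rewrite big_ord_recr /= -addSn leq_add //; first by apply: IHJ => j lt_j; apply: hd; apply: leqW.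
by rewrite leq_mul2r -ltnS prednK // hd ?orbT.
Qed.

Lemma digit_sum (d : nat -> nat) J j : (forall j, j < J -> d j < p) ->
  digit (\sum_(j < J) d j * p ^ j) j = if j < J then d j else 0.
Proof.
elim: J => [|J IHJ] hd; first by rewrite big_ord0 /digit div0n mod0n.
have hd' j' : j' < J -> d j' < p by move=> ?; apply: hd; apply: leqW.
rewrite big_ord_recr /= ltnS leq_eqVlt; have [->|nj] := eqVneq j J.
  rewrite ltnn /digit addnC divnMDl ?expn_gt0 ?p_gt0 // divn_small ?addn0; last exact: sum_digits_lt.
  by rewrite modn_small // hd.
have [lt|le] := ltnP j J; last first.
  rewrite /digit divn_small ?mod0n //=.
  have := sum_digits_lt hd; rewrite big_ord_recr /= => h; apply: leq_trans h _.
  by rewrite leq_exp2l //; lia.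
rewrite /= -[RHS](_ : digit (\sum_(j < J) d j * p ^ j) j = _); last by rewrite IHJ // lt.
rewrite /digit -(subnK (ltnW lt)) expnD mulnA subnK ?(ltnW lt) //.
rewrite addnC divnMDl ?expn_gt0 ?p_gt0 // -modnDm.
have -> : J - j = (J - j).-1.+1 by lia.
by rewrite expnS mulnCA modnMr add0n modn_mod.
Qed.

Lemma digit_ge m j : m < p ^ j -> digit m j = 0.
Proof. by move=> h; rewrite /digit divn_small ?mod0n. Qed.

Lemma expn_bound (ms : seq nat) : exists J, all (fun m => m < p ^ J) ms.
Proof.
elim: ms => [|m ms [J hJ]]; first by exists 0.
exists (maxn m J) => /=; apply/andP; split.
  by apply: leq_trans (ltn_expl m p_gt1) _; rewrite leq_exp2l // leq_maxl.
apply: sub_all hJ => k hk; apply: leq_trans hk _.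
by rewrite leq_exp2l // leq_maxr.
Qed.

Lemma digit_le_leq k m : digit_le k m -> k <= m.
Proof.
move=> h; have [J /= /and3P[hk hm _]] := expn_bound [:: k; m].
rewrite (digits_sum hk) (digits_sum hm); apply: leq_sum => j _.
by rewrite leq_mul2r h orbT.
Qed.

(** All [N] digits of [p ^ N - 1] are [p - 1], so subtracting [n] needs no borrow. *)
Lemma digit_compl n N j : n < p ^ N ->
  digit (p ^ N - n.+1) j = if j < N then p.-1 - digit n j else 0.
Proof.
move=> hn; have hd i : i < N -> p.-1 - digit n i < p by lia.
rewrite -(digit_sum j hd); congr digit.
suff -> : p ^ N = (\sum_(j < N) (p.-1 - digit n j) * p ^ j) + n.+1 by rewrite addnK.
rewrite {2}(digits_sum hn) addnS -big_split /=.
rewrite (eq_bigr (fun j : 'I_N => p.-1 * p ^ j)); last first.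
  by move=> i _; rewrite -mulnDl subnK //; have := digit_lt n i; lia.
elim: N {hn hd} => [|N IHN]; first by rewrite big_ord0.
by rewrite big_ord_recr /= -addSn -IHN expnS -{1}(prednK p_gt0) mulSn.
Qed.

End Digits.

(** * Slots left free by the digits of [n], and multiples of [p ^ e - 1] *)

Section Counting.

Variables (p e' n : nat).
Hypothesis p_gt1 : 1 < p.

Local Notation e := e'.+1.
Local Notation I := 'I_e.

Let p_gt0 : 0 < p. Proof. by lia. Qed.
Let pX_gt0 h : 0 < p ^ h. Proof. by rewrite expn_gt0 p_gt0. Qed.

(* The number of times that [p ^ j] is available for a number that has no carry
   when added to [n]. *)
Definition supply (j : nat) := p.-1 - digit p n j.

Definition cumul (d : nat -> nat) (x : I) (J : nat) := \sum_(j < J | j %% e == x) d j.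

Lemma cumulS d x J : cumul d x J.+1 = cumul d x J + (if J %% e == x then d J else 0).
Proof. by rewrite /cumul big_mkcond big_ord_recr /= -big_mkcond. Qed.

Lemma cumul_mono d x J J' : J <= J' -> cumul d x J <= cumul d x J'.
Proof.
move=> /subnKC <-; elim: (J' - J) => [|i IHi]; first by rewrite addn0.
by rewrite addnS cumulS (leq_trans IHi) ?leq_addr.
Qed.

Lemma supply_gt0 : exists N, forall j, N <= j -> 0 < supply j.
Proof.
have [N /= /andP[hn _]] := expn_bound p_gt1 [:: n].
exists N => j le_j; rewrite /supply digit_ge; first by lia.
by apply: leq_trans hn _; rewrite leq_exp2l.
Qed.

(** Beyond the last digit of [n] every position has positive supply, so each class has infinitely
    many units. *)
Lemma cumul_unbounded x k : exists J, k < cumul supply x J.+1.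
Proof.
have [N hN] := supply_gt0; exists ((N + k) * e + x).
have here i : 0 < supply ((N + i) * e + x).
  apply: hN; apply: leq_trans (leq_addr x _).
  by apply: (leq_trans (leq_addr i N)); exact: leq_pmulr.
have cl i : ((N + i) * e + x) %% e == x by rewrite modnMDl modn_small.
elim: k => [|k IHk]; first by rewrite cumulS cl (leq_trans (here 0)) ?leq_addl.
rewrite cumulS cl -[k.+2]addn1 leq_add ?here //; apply: leq_trans IHk _.
by apply: cumul_mono; rewrite addnS mulSn; lia.
Qed.

Definition slot (x : I) (k : nat) := ex_minn (cumul_unbounded x k).

Lemma slot_lt x k : k < cumul supply x (slot x k).+1.
Proof. by rewrite /slot; case: ex_minnP. Qed.

Lemma slot_le x k J : k < cumul supply x J.+1 -> slot x k <= J.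
Proof. by rewrite /slot; case: ex_minnP => m _; apply. Qed.

Lemma slot_ge x k : cumul supply x (slot x k) <= k.
Proof.
case E: (slot x k) => [|J]; first by rewrite /cumul big_ord0.
by rewrite leqNgt; apply/negP=> /slot_le; rewrite E ltnn.
Qed.

Lemma slot_mod x k : slot x k %% e = x.
Proof.
have := slot_lt x k; have := slot_ge x k; rewrite cumulS.
by case: eqP => // _; rewrite addn0; lia.
Qed.

Lemma slot_mono x k l : k <= l -> slot x k <= slot x l.
Proof. by move=> kl; apply: slot_le; apply: leq_ltn_trans kl (slot_lt x l). Qed.

Lemma slot_neq x y k l : x != y -> slot x k != slot y l.
Proof.
by apply: contraNneq => E; apply/eqP/val_inj; rewrite /= -(slot_mod x k) E slot_mod.
Qed.

Lemma slot_shift x k : slot x k + e <= slot x (k + p.-1).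
Proof.
have lt : slot x k < slot x (k + p.-1).
  rewrite ltnNge; apply/negP=> le.
  have := slot_lt x (k + p.-1); rewrite ltnNge => /negP; apply.
  apply: leq_trans (cumul_mono supply x (le : _ < (slot x k).+1)) _.
  rewrite cumulS; have := slot_ge x k; rewrite /supply.
  by case: ifP => _; lia.
have : slot x k = slot x (k + p.-1) %[mod e] by rewrite !slot_mod.
move=> /eqP; rewrite eq_sym eqn_mod_dvd ?(ltnW lt) // => /dvdn_leq.
by rewrite subn_gt0 lt => /(_ isT); lia.
Qed.

Local Notation load := (load p slot).
Local Notation value := (value p slot).

(** How many of the first [u] units of class [x] sit at position [j]. *)
Definition lowest (x : I) (u j : nat) :=
  minn (cumul supply x j.+1) u - minn (cumul supply x j) u.

Lemma load_lowest x u J : load x (minn (cumul supply x J) u) =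
  \sum_(j < J | j %% e == x) lowest x u j * p ^ j.
Proof.
elim: J => [|J IHJ].
  by rewrite big_ord0 /cumul big_ord0 min0n /load big_ord0.
rewrite big_mkcond big_ord_recr /= -big_mkcond -IHJ /lowest cumulS.
case: eqP => EJ; last by rewrite addn0 addn0.
have : minn (cumul supply x J) u <= minn (cumul supply x J + supply J) u by lia.
have : forall k, minn (cumul supply x J) u <= k ->
    k < minn (cumul supply x J + supply J) u -> slot x k = J.
  move=> k h1 h2; apply/eqP; rewrite eqn_leq; apply/andP; split.
    by apply: slot_le; rewrite cumulS EJ eqxx; lia.
  rewrite leqNgt; apply/negP=> lt.
  by have := slot_lt x k; have := cumul_mono supply x lt; lia.
move: (minn _ _) (minn (_ + _) _) => a b hk /subnKC <-; rewrite addKn.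
have {hk} : forall k, k < b - a -> slot x (a + k) = J by move=> k ?; apply: hk; lia.
elim: (b - a) => [|d IHd] hk; first by rewrite mul0n !addn0.
rewrite addnS loadS hk // IHd ?mulSn => [|k ?]; first by lia.
by apply: hk; lia.
Qed.

(** Filling a class from its lowest slots is cheapest: the units of [d] up to position [J] all fit
    into slots at [J] or below. *)
Lemma load_le (d : nat -> nat) x J : (forall j, d j <= supply j) ->
  load x (cumul d x J) <= \sum_(j < J | j %% e == x) d j * p ^ j.
Proof.
move=> hd; elim: J => [|J IHJ]; first by rewrite /cumul !big_ord0 /load big_ord0.
rewrite big_mkcond big_ord_recr /= -big_mkcond cumulS.
case: eqP => EJ; last by rewrite !addn0.
have hc i : cumul d x i <= cumul supply x i by apply: leq_sum => j _.
have : forall k, k < cumul d x J + d J -> slot x k <= J.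
  move=> k hk; apply: slot_le; apply: leq_trans (hc J.+1).
  by rewrite cumulS EJ eqxx.
move=> hs; apply: (@leq_trans (load x (cumul d x J) + d J * p ^ J)); last by rewrite leq_add2r.
elim: (d J) hs => [|k IHk] hs; first by rewrite mul0n !addn0.
rewrite addnS loadS mulSn.
have : p ^ slot x (cumul d x J + k) <= p ^ J by rewrite leq_exp2l // hs // addnS.
have hs' i : i < cumul d x J + k -> slot x i <= J by move=> hi; apply: hs; lia.
by have := IHk hs'; lia.
Qed.

Lemma sum_by_class (F : nat -> nat) J :
  \sum_(x : I) \sum_(j < J | j %% e == x) F j = \sum_(j < J) F j.
Proof.
by rewrite [RHS](partition_big (fun j : 'I_J => Ordinal (ltn_pmod j (ltn0Sn e'))) xpredT) //=.
Qed.

Definition fill (u : I -> nat) (j : nat) :=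
  let x := Ordinal (ltn_pmod j (ltn0Sn e')) in lowest x (u x) j.

Lemma value_fill u J : (forall x, u x <= cumul supply x J) ->
  value u = \sum_(j < J) fill u j * p ^ j.
Proof.
move=> hu; rewrite -(sum_by_class (fun j => fill u j * p ^ j)); apply: eq_bigr => x _.
rewrite -{1}(minn_idPr (hu x)) load_lowest; apply: eq_bigr => j /eqP Ej.
by rewrite /fill; congr (lowest _ (u _) _ * _); apply: val_inj; rewrite /= Ej.
Qed.

Lemma fill_le u j : fill u j <= supply j.
Proof. by rewrite /fill /lowest cumulS /= eqxx; lia. Qed.

Lemma fill_mono u u' j : (forall x, u x <= u' x) -> fill u j <= fill u' j.
Proof.
move=> h; rewrite /fill /lowest; set x := Ordinal _; have := h x.
by have := cumul_mono supply x (leqnSn j); lia.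
Qed.

Lemma slot_bound (u : I -> nat) h :
  (forall x k, k < u x -> slot x k < h) -> value u < p ^ h.
Proof.
move=> hs; rewrite (@value_fill u h).
  by apply: sum_digits_lt => // j _; have := fill_le u j; rewrite /supply; lia.
move=> x; case E: (u x) => [//|k]; apply: leq_trans (slot_lt x k) _.
by apply: cumul_mono; apply: hs; rewrite E.
Qed.

Local Notation Q := (p ^ e).
Local Notation us := (usage (@ordS e) p).

Lemma iter_ordS y (x : I) : iter y (@ordS e) x = (x + y) %% e :> nat.
Proof.
elim: y => [|y IHy] /=; first by rewrite addn0 modn_small.
by rewrite IHy -addn1 modnDml -addnA addn1.
Qed.

Lemma ordS_trans (x y : I) : exists k, iter k (@ordS e) x = y.
Proof.
exists (y + e - x); apply: ord_inj; rewrite iter_ordS.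
have -> : x + (y + e - x) = y + e by have := ltn_ord x; lia.
by rewrite modnDr modn_small.
Qed.

Lemma Q_gt1 : 1 < Q.
Proof. by rewrite -(expn0 p) ltn_exp2l. Qed.

(* The number with [u] as digits in base [p], read cyclically from [x]. *)
Definition turn (u : I -> nat) (x : I) := \sum_(y < e) u (iter y (@ordS e) x) * p ^ y.

(** After multiplication by [p], the reading from [ordS x] differs from the one from [x] only in the
    digit [u x], whose weight is [p ^ e] instead of 1. *)
Lemma turnS u x : p * turn u (ordS x) = turn u x + Q.-1 * u x.
Proof.
apply/eqP; rewrite -(eqn_add2r (u x)) -addnA -mulSnr (ltn_predK Q_gt1); apply/eqP.
rewrite {1}/turn big_ord_recr /= mulnDr -iterSr.
have -> : iter e'.+1 (@ordS e) x = x.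
  by apply: ord_inj; rewrite iter_ordS modnDr modn_small.
rewrite [in RHS]/turn big_ord_recl /= expn0 muln1 mulnCA -expnS (mulnC (u x)).
have -> : p * (\sum_(i < e') u (iter i (@ordS e) (ordS x)) * p ^ i) =
    \sum_(i < e') u (iter (bump 0 i) (@ordS e) x) * p ^ bump 0 i.
  by rewrite big_distrr /=; apply: eq_bigr => i _; rewrite -iterSr expnS mulnCA.
by rewrite addnAC (addnC _ (u x)).
Qed.

Lemma turn0 (u : I -> nat) : turn u ord0 = \sum_x u x * p ^ x.
Proof.
apply: eq_bigr => x _; congr (u _ * _); apply: ord_inj.
by rewrite iter_ordS add0n modn_small.
Qed.

(** Since [p] is prime to [Q.-1], [turnS] passes divisibility from one starting class to the
    next. *)
Lemma dvdn_turn (u : I -> nat) x : Q.-1 %| \sum_x u x * p ^ x -> Q.-1 %| turn u x.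
Proof.
rewrite -turn0 => h0; have [k <-] := ordS_trans ord0 x; elim: k => [//|k IHk].
have : Q.-1 %| p * turn u (iter k.+1 (@ordS e) ord0).
  by rewrite /= turnS dvdn_addr ?dvdn_mulr.
rewrite Gauss_dvdr // coprime_sym -(@coprime_pexpl e) //.
by rewrite -{1}(ltn_predK Q_gt1) coprimeSn.
Qed.

Definition carry (u : I -> nat) (x : I) := turn u x %/ Q.-1.

Lemma carryE (u : I -> nat) x : Q.-1 %| \sum_x u x * p ^ x ->
  p * carry u (ordS x) = carry u x + u x.
Proof.
move=> h; have q0 : 0 < Q.-1 by have := Q_gt1; lia.
apply/eqP; rewrite -(eqn_pmul2r q0) -mulnA mulnDl !divnK ?dvdn_turn //.
by rewrite turnS (mulnC (u x)).
Qed.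

Lemma modn_sum_congr J (P : pred 'I_J) (F G : 'I_J -> nat) m :
  (forall j, P j -> F j = G j %[mod m]) ->
  \sum_(j | P j) F j = \sum_(j | P j) G j %[mod m].
Proof. by move=> h; rewrite -modn_summ (eq_bigr _ h) modn_summ. Qed.

Lemma expn_period j : p ^ j = p ^ (j %% e) %[mod Q.-1].
Proof.
rewrite {1}(divn_eq j e) (mulnC (j %/ e)) expnD expnM -modnMml -modnXm.
have -> : Q %% Q.-1 = 1 %% Q.-1.
  by rewrite -{1}(ltn_predK Q_gt1) -addn1 modnDl.
by rewrite modnXm exp1n modnMml mul1n.
Qed.

Lemma value_mod (u : I -> nat) : value u = \sum_x u x * p ^ x %[mod Q.-1].
Proof.
apply: modn_sum_congr => x _;
have -> : u x * p ^ x = \sum_(k < u x) p ^ x by rewrite sum_nat_const card_ord.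
by apply: modn_sum_congr => k _; rewrite expn_period slot_mod.
Qed.

(** Weighted usages telescope: [k] steps from [x] add up to [p ^ k * t (iter k S x) - t x], which is
    [Q.-1 * t x] after a full turn. *)
Lemma sum_usage (t : I -> nat) : feasible (@ordS e) p t -> Q.-1 %| \sum_x us t x * p ^ x.
Proof.
move=> tf; rewrite -turn0; apply/dvdnP; exists (t ord0).
suff E x : turn (us t) x + t x = Q * t x.
  by have := E ord0; rewrite -{1}(ltn_predK Q_gt1) mulSn mulnC; lia.
rewrite /turn.
have H k : \sum_(y < k) us t (iter y (@ordS e) x) * p ^ y + t x =
   p ^ k * t (iter k (@ordS e) x).
  elim: k => [|k IHk]; first by rewrite big_ord0 expn0 mul1n.
  rewrite big_ord_recr /= addnAC IHk [X in _ + X = _]mulnC -mulnDr expnSr -mulnA; congr (_ * _).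
  by have := tf (iter k (@ordS e) x); rewrite /usage; lia.
rewrite H; congr (_ * t _); apply: ord_inj.
by rewrite iter_ordS modnDr modn_small.
Qed.

Lemma number_mod M N : M < p ^ N ->
  M = \sum_x cumul (digit p M) x N * p ^ x %[mod Q.-1].
Proof.
move=> /digits_sum {1}->; rewrite -(sum_by_class (fun j => digit p M j * p ^ j)).
apply: modn_sum_congr => x _; rewrite big_distrl /=.
by apply: modn_sum_congr => j /eqP <-; rewrite -modnMmr expn_period modnMmr.
Qed.

Definition number_chain D m (M : nat -> nat) :=
  [/\ forall i, i < D -> Q.-1 %| M i, forall i, i.+1 < D -> M i < M i.+1,
      0 < D -> 0 < M 0, forall i, i.+1 < D -> digit_le p (M i) (M i.+1)
    & 0 < D -> digit_le p (M D.-1) m].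

Lemma number_chain_le D m M i : number_chain D m M -> i < D -> digit_le p (M i) m.
Proof.
move=> [_ _ _ Mle Mm] lt_i.
have /subnKC Ei : i <= D.-1 by lia.
move: (D.-1 - i) Ei => d; elim: d => [|d IHd] in i lt_i *.
  by rewrite addn0 => ->; apply: Mm; lia.
move=> Ei j; apply: (@leq_trans (digit p (M i.+1) j)).
  by apply: Mle; lia.
by apply: IHd; lia.
Qed.

Section Weights.

Variable delta : nat -> nat.
Hypothesis delta0 : delta 0 <= 2.
Hypothesis deltaS : forall i, delta i.+1 <= 1.
Hypothesis delta_gt0 : forall i, 0 < delta i.

Definition number_cost D (M : nat -> nat) := \sum_(i < D) delta i * M i.

Local Notation chain := (chain (@ordS e) p).
Local Notation cost := (cost (@ordS e) p slot delta).
(** A chain capped by its own top usage is a chain without a cap. *)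
Local Notation C t D := (chain D (us (t D.-1)) t).

Lemma chain_of_numbers D N M : n < p ^ N -> number_chain D (p ^ N - n.+1) M ->
  exists t : nat -> I -> nat, C t D /\ forall i, i < D -> value (us (t i)) <= M i.
Proof.
move=> hn MP; have Mle := fun i => @number_chain_le D _ M i MP.
have [Mdv Minc M0 Mnest _] := MP.
have MN i : i < D -> M i < p ^ N.
  by move=> /Mle/(digit_le_leq p_gt1) h; have := pX_gt0 N; lia.
have Msup i j : i < D -> digit p (M i) j <= supply j.
  move=> lt_i; apply: leq_trans (Mle i lt_i j) _; rewrite digit_compl //.
  by rewrite /supply; case: ifP.
pose u i x := cumul (digit p (M i)) x N; pose t i := carry (u i).
have tE i x : i < D -> p * t i (ordS x) = t i x + u i x.
  move=> lt_i; apply: carryE; rewrite /dvdn.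
  by rewrite -(number_mod (MN i lt_i)) (eqP (Mdv i lt_i)).
have usE i x : i < D -> us (t i) x = u i x.
  by move=> lt_i; rewrite /usage tE // addKn.
have Mu i : i < D -> M i = \sum_(x : I) \sum_(j < N | j %% e == x) digit p (M i) j * p ^ j.
  by move=> lt_i; rewrite (sum_by_class (fun j => digit p (M i) j * p ^ j)) -digits_sum ?MN.
have ule i x : i.+1 < D -> u i x <= u i.+1 x.
  by move=> lt_i; apply: leq_sum => j _; apply: Mnest.
have q0 : 0 < Q.-1 by have := Q_gt1; lia.
have turnE i x : i < D -> turn (u i) x = t i x * Q.-1.
  move=> lt_i; rewrite divnK // dvdn_turn // /dvdn.
  by rewrite -(number_mod (MN i lt_i)) (eqP (Mdv i lt_i)).
(* Equal readings would force equal digit counts, then equal digits by nesting, hence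
   [M i = M i.+1]. *)
have turn_lt i x : i.+1 < D -> turn (u i) x < turn (u i.+1) x.
  move=> lt_i; have le y : u i (iter y (@ordS e) x) * p ^ y <=
      u i.+1 (iter y (@ordS e) x) * p ^ y by rewrite leq_mul2r ule ?orbT.
  rewrite ltn_neqAle andbC leq_sum //=.
  apply/negP=> /eqP Et.
  have Eu y : u i y = u i.+1 y.
    have [k Ek] := ordS_trans x y.
    have lt_k : (k %% e) < e by rewrite ltn_mod.
    have Ek' : iter (k %% e) (@ordS e) x = y.
      by apply: ord_inj; rewrite -Ek !iter_ordS modnDmr.
    move: Et; rewrite /turn (bigD1 (Ordinal lt_k)) //= [in RHS](bigD1 (Ordinal lt_k)) //=.
    rewrite Ek' => Et.
    have : \sum_(j < e | j != Ordinal lt_k) u i (iter j (@ordS e) x) * p ^ j <=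
       \sum_(j < e | j != Ordinal lt_k) u i.+1 (iter j (@ordS e) x) * p ^ j.
      by apply: leq_sum => j _.
    move=> h; apply/eqP; rewrite eqn_leq ule //= -(leq_pmul2r (pX_gt0 (k %% e))).
    by rewrite -(leq_add2r (\sum_(j < e | j != Ordinal lt_k) u i (iter j (@ordS e) x) * p ^ j)) Et leq_add2l.
  have : M i < M i.+1 by apply: Minc.
  rewrite (Mu i) ?(ltnW lt_i) // (Mu i.+1) // ltnNge => /negP; apply.
  apply: leq_sum => y _; apply: leq_sum => j Ej; rewrite leq_mul2r; apply/orP; right.
  have := Eu y; rewrite /u /cumul (bigD1 j) //= [in RHS](bigD1 j) //=.
  have : \sum_(i0 < N | (i0 %% e == y) && (i0 != j)) digit p (M i) i0 <=
     \sum_(i0 < N | (i0 %% e == y) && (i0 != j)) digit p (M i.+1) i0.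
    by apply: leq_sum => ? _; apply: Mnest.
  clear; move: (\sum_(_ < N | _) digit p (M i) _) (\sum_(_ < N | _) digit p (M i.+1) _).
  by move: (digit _ _ _) (digit _ _ _); lia.
have t0 x : 0 < D -> 0 < t 0 x.
  move=> D0; rewrite lt0n; apply/negP=> /eqP tx.
  have tf : feasible (@ordS e) p (t 0) by move=> y; rewrite tE // leq_addr.
  have z := feasible_eq0 p_gt1 ordS_trans tf tx.
  have := M0 D0; rewrite lt0n => /eqP; apply; rewrite (Mu 0 D0) big1 // => y _.
  have : u 0 y = 0 by have := tE 0 y D0; rewrite !z; lia.
  move=> /eqP; rewrite sum_nat_eq0 => /forall_inP h.
  by apply: big1 => j Ej; rewrite (eqP (h j Ej)).
exists t; split; first split=> //.
- by move=> i lt_i x; rewrite tE // leq_addr.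
- by move=> i x lt_i; rewrite -(ltn_pmul2r q0) -!turnE ?(ltnW lt_i) // turn_lt.
- by move=> i x lt_i; rewrite !usE ?(ltnW lt_i) ?ule.
move=> i lt_i; rewrite (Mu i lt_i); apply: leq_sum => x _.
by rewrite usE //; apply: load_le => // j; apply: Msup.
Qed.

(** The values have the digits [fill], which stay below the complement of [n] once [N] exceeds every
    position used. *)
Lemma numbers_of_chain D t : C t D -> exists N0, n < p ^ N0 /\
  forall N, N0 <= N -> number_chain D (p ^ N - n.+1) (fun i => value (us (t i))).
Proof.
move=> tP; have [tf tinc tpos tus _] := tP.
have usup i x : i < D -> us (t i) x <= us (t D.-1) x.
  move=> lt_i; have /subnKC <- : i <= D.-1 by lia.
  have : i + (D.-1 - i) < D by lia.
  elim: (D.-1 - i) => [|d IHd] lt; first by rewrite addn0.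
  by rewrite addnS in lt *; apply: leq_trans (tus _ _ lt); apply: IHd; lia.
have [J hJ] : exists J, forall x, us (t D.-1) x <= cumul supply x J.
  exists (\max_x (slot x (us (t D.-1) x)).+1) => x.
  apply: leq_trans (ltnW (slot_lt x _)) _.
  by apply: cumul_mono; exact: leq_bigmax.
have [N1 /= /andP[hn _]] := expn_bound p_gt1 [:: n].
have fillJ i J' : i < D -> J <= J' -> value (us (t i)) = \sum_(j < J') fill (us (t i)) j * p ^ j.
  move=> lt_i le; apply: value_fill => x; apply: leq_trans (usup i x lt_i) _.
  by apply: leq_trans (hJ x) _; apply: cumul_mono.
have flt u j : fill u j < p by have := fill_le u j; rewrite /supply; lia.
have dig i J' j : i < D -> J <= J' ->
    digit p (value (us (t i))) j = if j < J' then fill (us (t i)) j else 0.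
  by move=> lt_i le; rewrite (fillJ i J') // digit_sum.
exists (maxn N1 J); split.
  by apply: leq_trans hn _; rewrite leq_exp2l // leq_maxl.
move=> N; rewrite geq_max => /andP[le1 leJ].
have nN : n < p ^ N by apply: leq_trans hn _; rewrite leq_exp2l.
have q0 : 0 < Q.-1 by have := Q_gt1; lia.
split=> [i lt_i|i lt_i|D0|i lt_i j|D0 j].
- by rewrite /dvdn value_mod; apply: sum_usage; apply: tf.
- rewrite ltn_neqAle; apply/andP; split; last first.
    by apply: leq_sum => x _; apply: load_mono => //; exact: tus.
  (* Equal values give equal usages, so the positive differences of the carries would be multiplied
     by [p ^ e] in a full turn. *)
  apply/negP=> /eqP Ev.
  have Eu := @value_inj _ p e _ p_gt1 isT slot_mono slot_neq slot_bound _ _ Ev.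
  have tE x : p * (t i.+1 (ordS x) - t i (ordS x)) = t i.+1 x - t i x.
    have := Eu x; have := tf _ (ltnW lt_i) x; have := tf _ lt_i x; rewrite /usage mulnBr.
    by have := tinc i x lt_i; lia.
  pose d x := t i.+1 x - t i x.
  have dE k : d ord0 = p ^ k * d (iter k (@ordS e) ord0).
    elim: k => [|k IHk]; first by rewrite mul1n.
    by rewrite IHk iterS expnSr -mulnA; congr (_ * _); rewrite /d tE.
  have := dE e; have -> : iter e (@ordS e) ord0 = ord0.
    by apply: ord_inj; rewrite iter_ordS modnn.
  by have := Q_gt1; have := tinc i ord0 lt_i; rewrite /d; nia.
- case: D D0 tP {tf tinc tpos tus usup hJ fillJ dig} => // D _ tP.
  exact: (@chain_value_gt0 _ _ p e slot p_gt1 isT ordS_trans delta delta0 D _ t tP ord0 0 isT).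
- rewrite !(dig _ N) ?(ltnW lt_i) //; case: ifP => // _.
  by apply: fill_mono => x; exact: tus.
rewrite (dig _ N) ?prednK // digit_compl //; case: ifP => // _.
exact: fill_le.
Qed.

(** Any number chain yields a carry chain of no greater cost, so a least carry chain gives a least
    number chain, the same for all large [N]; in case of equality the two agree level by level. *)
Lemma number_chain_unique D : exists (M : nat -> nat) N0, n < p ^ N0 /\
  forall N, N0 <= N -> number_chain D (p ^ N - n.+1) M /\
    forall M', number_chain D (p ^ N - n.+1) M' ->
      number_cost D M <= number_cost D M' /\
      (number_cost D M' = number_cost D M -> forall i, i < D -> M' i = M i).
Proof.
pose P t := C t D.
have ex0 : P (fun i x => i.+1).
  split=> // [i _ x|i x _]; first by rewrite leq_pmull.
  by rewrite /usage; move: p_gt1; clear; nia.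
have [t tP tmin] := @ex_argmin _ P (cost D) (ex_intro _ _ ex0).
have [N0 [hN0 nums]] := numbers_of_chain tP.
exists (fun i => value (us (t i))), N0; split=> // N leN; split; first exact: nums.
move=> M MP.
have hN : n < p ^ N by apply: leq_trans hN0 _; rewrite leq_exp2l.
have [t' [t'P t'M]] := chain_of_numbers hN MP.
have le1 : cost D t' <= number_cost D M.
  by apply: leq_sum => i _; rewrite leq_mul2l t'M ?orbT.
have le2 := tmin _ t'P; split; first exact: leq_trans le2 le1.
move=> Ec; have E1 : cost D t' = number_cost D M.
  by apply/eqP; rewrite eqn_leq le1 Ec /number_cost le2.
have E2 : cost D t' = cost D t by rewrite E1 Ec.
move=> i lt_i.
have -> : M i = value (us (t' i)).
  have := E1; rewrite /cost /number_cost (bigD1 (Ordinal lt_i)) //=.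
  rewrite [in RHS](bigD1 (Ordinal lt_i)) //=.
  have : \sum_(j < D | j != Ordinal lt_i) delta j * value (us (t' j)) <=
     \sum_(j < D | j != Ordinal lt_i) delta j * M j.
    by apply: leq_sum => j _; rewrite leq_mul2l t'M ?orbT.
  move=> h E; apply/eqP; rewrite eqn_leq t'M // andbT -(leq_pmul2l (delta_gt0 i)).
  by rewrite -(leq_add2r (\sum_(j < D | j != Ordinal lt_i) delta j * value (us (t' j)))) E leq_add2l.
(* Uniqueness is stated for a fixed capacity, so both chains are placed under a common one. *)
pose cap x := maxn (us (t D.-1) x) (us (t' D.-1) x).
have widen y : C y D -> (forall x, us (y D.-1) x <= cap x) -> chain D cap y.
  by move=> [? ? ? ? _] h; split.
have narrow y : chain D cap y -> C y D by move=> [? ? ? ? _]; split.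
apply: eq_bigr => x _; congr load.
apply: (@optimal_chain_unique _ (@ordS e) p e slot p_gt1 isT _ ordS_trans slot_mono
  slot_neq slot_shift slot_bound _ delta0 deltaS delta_gt0 D cap t' t ord0) => //.
- move=> a b; rewrite -val_eqE; have := ltn_ord a; have := ltn_ord b; rewrite /=; lia.
- by apply: widen => // y; rewrite leq_maxr.
- by move=> y /narrow/tmin; rewrite E2.
- by apply: widen => // y; rewrite leq_maxl.
by move=> y /narrow/tmin.
Qed.

End Weights.
End Counting.

Import Order.TTheory GRing.Theory Num.Theory.
Local Open Scope ring_scope.

(** * Lucas' theorem and power sums over F *)

Section Lucas.

Variables (R : idomainType) (p : nat).
Hypothesis pcharRp : p \in [pchar R].

Let p_pr : prime p := pcharf_prime pcharRp.
Let p_gt0 : (0 < p)%N := prime_gt0 p_pr.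

Lemma coef_1X_exp m j : ((1 + 'X : {poly R}) ^+ m)`_j = 'C(m, j)%:R.
Proof.
rewrite addrC exprD1n coef_sum.
under eq_bigr => i _ do rewrite coefMn coefXn.
have [lt|ge] := ltnP j m.+1; last first.
  rewrite bin_small // big1 // => i _; case: eqP => [E|_]; last by rewrite mul0rn.
  by move: (ltn_ord i) ge; rewrite E; lia.
rewrite (bigD1 (Ordinal lt)) //= eqxx big1 ?addr0 // => i ne.
by rewrite eq_sym -val_eqE in ne *; rewrite (negPf ne) mul0rn.
Qed.

(** Compare coefficients in [(1 + X)^(pa+b) = (1 + X^p)^a (1 + X)^b]; as [b] and [d] are below [p],
    only one product of terms contributes. *)
Lemma lucas_step a b c d : (b < p)%N -> (d < p)%N ->
  'C(p * a + b, p * c + d)%:R = 'C(a, c)%:R * 'C(b, d)%:R :> R.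
Proof.
move=> lt_b lt_d; rewrite -coef_1X_exp exprD exprM.
have -> : (1 + 'X : {poly R}) ^+ p = (1 + 'X) \Po 'X^p.
  rewrite exprDn_pchar ?expr1n ?comp_polyD ?comp_polyX ?comp_polyC //.
  by rewrite pnatE // pchar_poly.
rewrite -[in LHS](rmorphXn (comp_poly _)) /= -!coef_1X_exp coefM.
have lt : (p * c < (p * c + d).+1)%N by lia.
rewrite (bigD1 (Ordinal lt)) //= coef_comp_poly_Xn // dvdn_mulr // mulKn //.
rewrite addKn big1 ?addr0 // => -[i /= lt_i]; rewrite -val_eqE /= => ne.
rewrite coef_comp_poly_Xn //; case: dvdnP => [[i' Ei]|_]; last by rewrite mul0r.
rewrite [X in _ * X](_ : _ = 0) ?mulr0 // coef_1X_exp bin_small //.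
have lt_i' : (i' < c)%N.
  have : (i' * p <= c * p + d)%N by rewrite -Ei mulnC; lia.
  by rewrite ltn_neqAle; case: eqP => [E|_]; [rewrite Ei E mulnC eqxx in ne | nia].
have : (i'.+1 * p <= c * p)%N by rewrite leq_mul2r lt_i' orbT.
by rewrite Ei mulSn (mulnC p c); lia.
Qed.

Lemma binomial_char m k : ('C(m, k)%:R != 0 :> R) <-> digit_le p k m.
Proof.
have small b d : (b < p)%N -> ('C(b, d)%:R != 0 :> R) = (d <= b)%N.
  move=> lt_b; rewrite -(dvdn_pcharf pcharRp); have [le|lt] := leqP d b; last first.
    by rewrite bin_small ?dvdn0.
  apply/negP => /(dvdn_mulr (d`! * (b - d)`!)); rewrite bin_fact // => h.
  have : ~~ (p %| b`!)%N.
    elim: b lt_b {le h d} => [|b IHb] lt_b; first by rewrite fact0 Euclid_dvd1.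
    rewrite factS Euclid_dvdM // negb_or IHb ?(ltnW lt_b) // andbT.
    by apply/negP => /dvdn_leq; lia.
  by rewrite h.
have d0 n : digit p n 0 = (n %% p)%N by rewrite /digit expn0 divn1.
have dS n j : digit p n j.+1 = digit p (n %/ p) j by rewrite /digit expnS divnMA.
elim/ltn_ind: m k => m IHm k.
have [->|m_gt0] := posnP m.
  rewrite bin0n; case: k => [|k]; first by rewrite /= oner_eq0; split=> // _ j.
  rewrite /= eqxx; split=> // h.
  by have := digit_le_leq (prime_gt1 p_pr) h.
have lt_m : (m %/ p < m)%N by rewrite ltn_Pdiv ?prime_gt1.
rewrite {1}(divn_eq m p) {1}(divn_eq k p) ![(_ %/ p * p)%N]mulnC.
rewrite lucas_step ?ltn_mod // mulf_eq0 negb_or; split.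
  case/andP=> /(IHm _ lt_m) h; rewrite (small (m %% p)%N) ?ltn_mod // => h0 [|j]; first by rewrite !d0.
  by rewrite !dS.
move=> h; rewrite (small (m %% p)%N) ?ltn_mod //; have := h 0%N; rewrite !d0 => ->; rewrite andbT.
by apply/(IHm _ lt_m) => j; rewrite -!dS.
Qed.

End Lucas.

Section PowerSums.

Variable F : finFieldType.

Lemma card_pchar_pow p : p \in [pchar F] -> exists n, #|F| = (p ^ n.+1)%N.
Proof.
move=> pF; have := card_pprimeChar pF; rewrite -[#|pPrimeCharType pF|]/#|F|.
case: (logn _ _) => [|n] E; last by exists n.
by have := finNzRing_gt1 F; rewrite E.
Qed.

(** If some [b != 0] has [b ^ k != 1], replacing [c] by [b * c] shows that the sum vanishes; [b]
    exists because [X^r - 1], [r] the residue of [k], has too few roots. For [k = 0] the convention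
    for [0 ^ 0] makes the sum [#|F| = 0]. *)
Lemma sum_expr k : \sum_(c : F) c ^+ k = if (0 < k)%N && (#|F|.-1 %| k)%N then -1 else 0.
Proof.
have card1 : #|F|%:R = 0 :> F.
  have [p p_pr pF] := finPcharP F; have [n Fn] := card_pchar_pow pF.
  by rewrite Fn natrX (pcharf0 pF) expr0n.
have [->|k_gt0] /= := posnP k; first by under eq_bigr do rewrite expr0; rewrite sumr_const.
case: ifP => [/dvdnP[l El]|ndv].
  rewrite (bigD1 0) //= expr0n (gtn_eqF k_gt0) add0r.
  rewrite (eq_bigr (fun=> 1)) => [|c c0]; last first.
    have := expf_card c; rewrite -(prednK (ltnW (finNzRing_gt1 F))) exprS.
    by rewrite -[in RHS](mulr1 c) => /(mulfI c0) h; rewrite El mulnC exprM h expr1n.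
  rewrite sumr_const cardC1; apply/eqP; rewrite -subr_eq0 opprK.
  by rewrite -mulrSr prednK ?card1 // ltnW // finNzRing_gt1.
have [b b0 hb] : exists2 b : F, b != 0 & b ^+ k != 1.
  apply/exists_inP; rewrite -[X in is_true X]negbK; apply/negP; rewrite negb_exists_in => /forall_inP h.
  pose r := (k %% #|F|.-1)%N.
  have r_lt : (r < #|F|.-1)%N by rewrite ltn_mod; have := finNzRing_gt1 F; case: #|F| => [|[]].
  have r0 : (0 < r)%N by rewrite lt0n; apply/negbT.
  have root1 (c : F) : c != 0 -> root ('X^r - 1) c.
    move=> c0; rewrite rootE !hornerE subr_eq0; move: (h c c0); rewrite negbK => /eqP hc.
    have hF : c ^+ #|F|.-1 = 1.
      have := expf_card c; rewrite -(prednK (ltnW (finNzRing_gt1 F))) exprS.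
      by rewrite -[in RHS](mulr1 c) => /(mulfI c0).
    by move: hc; rewrite {1}(divn_eq k #|F|.-1) exprD mulnC exprM hF expr1n mul1r => ->.
  have := @max_poly_roots _ ('X^r - 1) (enum [pred c : F | c != 0]).
  rewrite -size_poly_eq0 size_XnsubC // => /(_ isT).
  rewrite enum_uniq -cardE.
  have -> : all (root ('X^r - 1)) (enum [pred c : F | c != 0]).
    by apply/allP => c; rewrite mem_enum => /root1.
  move=> /(_ isT isT); rewrite ltnS.
  have -> : #|[pred c : F | c != 0]| = #|F|.-1 by rewrite -(cardC1 0); apply: eq_card.
  by rewrite leqNgt r_lt.
have [b' bK b'K] : bijective ( *%R b) by exists ( *%R b^-1) => x; rewrite ?mulKf ?mulVKf.
have E : b ^+ k * \sum_(c : F) c ^+ k = \sum_(c : F) c ^+ k.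
  rewrite [in RHS](reindex ( *%R b)) /=; last by exists b' => x _; rewrite ?bK ?b'K.
  by rewrite mulr_sumr; apply: eq_bigr => c _; rewrite exprMn.
apply/eqP; move/eqP: E; rewrite -subr_eq0 -{2}[\sum__ _]mul1r -mulrBl mulf_eq0.
by rewrite subr_eq0 (negPf hb).
Qed.

End PowerSums.

(** * Valuations of power sums *)

Section Valuation.

Variables (k : fieldType) (v : k -> int).
Hypothesis vP : is_valuation v.

Lemma valr0 : v 0 = 0. Proof. by case: vP. Qed.

Lemma valrM x y : x != 0 -> y != 0 -> v (x * y) = v x + v y.
Proof. by case: vP => _ h _ _; apply: h. Qed.

Lemma valr1 : v 1 = 0.
Proof. by have := valrM (oner_neq0 k) (oner_neq0 k); rewrite mulr1; lra. Qed.

Lemma valrV x : v x^-1 = - v x.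
Proof.
have [->|x0] := eqVneq x 0; first by rewrite invr0 valr0.
by have := valrM x0 (invr_neq0 x0); rewrite divff // valr1; lra.
Qed.

Lemma valrX x n : v (x ^+ n) = v x *+ n.
Proof.
have [->|x0] := eqVneq x 0; first by rewrite expr0n; case: n => [|n]; rewrite ?valr0 ?valr1 // mul0rn.
by elim: n => [|n IHn]; rewrite ?valr1 // exprS valrM ?expf_neq0 // IHn mulrS.
Qed.

Lemma valrN x : v (- x) = v x.
Proof.
have [->|x0] := eqVneq x 0; first by rewrite oppr0.
have := valrX (- x) 2; rewrite sqrrN valrX !mulr2n; lra.
Qed.

Lemma valr_prod (I : Type) (l : seq I) (f : I -> k) : (forall i, f i != 0) ->
  \prod_(i <- l) f i != 0 /\ v (\prod_(i <- l) f i) = \sum_(i <- l) v (f i).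
Proof.
move=> f0; elim: l => [|i l [n0 E]]; first by rewrite !big_nil oner_neq0 valr1.
by rewrite !big_cons valrM // E mulf_neq0.
Qed.

Lemma val_geN n x : val_ge v n x -> val_ge v n (- x).
Proof. by case=> [->|h]; [left; rewrite oppr0 | right; rewrite valrN]. Qed.

Lemma val_ge_le m n x : m <= n -> val_ge v n x -> val_ge v m x.
Proof. by move=> le [->|h]; [left | right; apply: le_trans h]. Qed.

Lemma val_geD n x y : val_ge v n x -> val_ge v n y -> val_ge v n (x + y).
Proof.
have [-> _|x0] := eqVneq x 0; first by rewrite add0r.
have [-> hx _|y0] := eqVneq y 0; first by rewrite addr0.
have [-> _ _|xy0] := eqVneq (x + y) 0; first by left.
case=> [E|hx]; first by rewrite E eqxx in x0.
case=> [E|hy]; first by rewrite E eqxx in y0.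
right; case: vP => _ _ h _; apply: le_trans (h _ _ x0 y0 xy0).
by rewrite le_min hx hy.
Qed.

Lemma val_geB n x y : val_ge v n x -> val_ge v n y -> val_ge v n (x - y).
Proof. by move=> hx hy; apply: val_geD => //; apply: val_geN. Qed.

Lemma val_ge_sum n (T : eqType) (L : seq T) (P : pred T) (f : T -> k) :
  {in L, forall l, P l -> val_ge v n (f l)} -> val_ge v n (\sum_(l <- L | P l) f l).
Proof.
move=> h; rewrite big_seq_cond; elim/big_rec: _ => [|l x /andP[lL Pl] hx]; first by left.
by apply: val_geD => //; apply: h.
Qed.

Lemma val_geM m n x y : val_ge v m x -> val_ge v n y -> val_ge v (m + n) (x * y).
Proof.
case: (eqVneq x 0) => [->|x0]; first by left; rewrite mul0r.
case: (eqVneq y 0) => [->|y0]; first by left; rewrite mulr0.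
case=> [E|hx]; first by rewrite E eqxx in x0.
case=> [E|hy]; first by rewrite E eqxx in y0.
by right; rewrite valrM // lerD.
Qed.

Lemma val_geX m n x : val_ge v m x -> val_ge v (m *+ n) (x ^+ n).
Proof.
move=> h; elim: n => [|n IHn]; first by right; rewrite valr1.
by rewrite exprS mulrS; apply: val_geM.
Qed.

Lemma val_ge_refl x : val_ge v (v x) x.
Proof. by right. Qed.

Lemma val_geW n x : x != 0 -> val_ge v n x -> n <= v x.
Proof. by move=> x0 [E|//]; rewrite E eqxx in x0. Qed.

Lemma val_addl x y : x != 0 -> val_ge v (v x + 1) y -> x + y != 0 /\ v (x + y) = v x.
Proof.
move=> x0 hy; have xy0 : x + y != 0.
  apply/negP; rewrite addr_eq0 => /eqP E; move: hy => /val_geN; rewrite -E.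
  by move=> /(val_geW x0); lra.
split=> //; apply/eqP; rewrite eq_le; apply/andP; split; last first.
  apply: (val_geW xy0); apply: val_geD; first exact: val_ge_refl.
  by apply: val_ge_le hy; lra.
rewrite leNgt; apply/negP => lt.
have /(val_geW x0) : val_ge v (v x + 1) x; last by lra.
by rewrite -{2}(addrK y x); apply: val_geB => //; right; rewrite lezD1.
Qed.

Lemma val_sum_dominant (T : eqType) (L : seq T) (f : T -> k) l0 :
  uniq L -> l0 \in L -> f l0 != 0 ->
  {in L, forall l, l != l0 -> val_ge v (v (f l0) + 1) (f l)} ->
  \sum_(l <- L) f l != 0 /\ v (\sum_(l <- L) f l) = v (f l0).
Proof.
move=> Lu Ll0 f0 h; rewrite (bigD1_seq l0) //=.
by apply: val_addl => //; apply: val_ge_sum.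
Qed.

End Valuation.

(** * Expansion of power sums over chains *)

Section Expansion.

Variables (F : finFieldType) (k : fieldType) (iota : {rmorphism F -> k}).
Variables (p e' : nat).
Hypothesis pcharFp : p \in [pchar F].
Hypothesis cardF : #|F| = (p ^ e'.+1)%N.
Variable X : nat -> k.

Fixpoint lins D : seq k :=
  if D is D'.+1 then [seq a + iota c * X D' | a <- lins D', c <- enum F] else [:: 0].

(* The condition for the terms in [X D ^+ (M - M')] to survive summation. *)
Definition jump M' M := (#|F|.-1 %| M - M')%N && ('C(M, M')%:R != 0 :> F).

(* Chains are listed from their last element M_(D-1) = M down to M_0. *)
Fixpoint chains D M : seq (seq nat) :=
  if D is D'.+1 then
    [seq M :: l | M' <- [seq M' <- index_iota 0 M | jump M' M], l <- chains D' M']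
  else if M == 0%N then [:: [::]] else [::].

Fixpoint term (l : seq nat) : k :=
  if l is M :: l' then
    - iota 'C(M, head 0%N l')%:R * X (size l') ^+ (M - head 0%N l') * term l'
  else 1.

Lemma chains_spec D M l : l \in chains D M -> size l = D /\ head 0%N l = M.
Proof.
elim: D M l => [|D IHD] M l /=; first by case: eqP => [->|_] //; rewrite inE => /eqP->.
by case/allpairsPdep=> M' [l' [_ /IHD[<- _] ->]].
Qed.

Lemma chains_uniq D M : uniq (chains D M).
Proof.
elim: D M => [|D IHD] M /=; first by case: eqP.
apply: allpairs_uniq_dep; first by rewrite filter_uniq // iota_uniq.
  by move=> M' _; apply: IHD.
move=> [M1 l1] [M2 l2] /allpairsPdep[x1 [y1 [_ h1 E1]]] /allpairsPdep[x2 [y2 [_ h2 E2]]] /= [El].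
case: E1 h1 El => -> -> h1 El; case: E2 h2 El => -> -> h2 El.
move: (chains_spec h1) (chains_spec h2); rewrite El => -[_ ->] [_ ->].
by [].
Qed.

(** Expand in the coefficient of the last basis element and sum over it: only the exponents allowed
    by [jump] survive, each with a factor [-1] and a power sum over one element less. *)
Lemma sum_lins_exp D M : \sum_(a <- lins D) a ^+ M = \sum_(l <- chains D M) term l.
Proof.
elim: D M => [|D IHD] M /=.
  by rewrite big_seq1 expr0n; case: eqP => _; rewrite ?big_seq1 ?big_nil.
rewrite big_allpairs_dep /= [RHS]big_allpairs_dep /= big_filter.
transitivity (\sum_(0 <= M' < M.+1) (\sum_(c : F) iota c ^+ (M - M')) *
     (iota 'C(M, M')%:R * X D ^+ (M - M')) * \sum_(a <- lins D) a ^+ M').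
  under [RHS]eq_bigr => M' _ do rewrite mulr_sumr.
  rewrite [RHS]exchange_big /=; apply: eq_bigr => a _.
  under [RHS]eq_bigr => M' _ do rewrite -mulrA mulr_suml.
  rewrite [RHS]exchange_big /= big_enum /=; apply: eq_bigr => c _.
  rewrite (addrC a) exprDn big_mkord; apply: eq_bigr => i _.
  rewrite exprMn rmorph_nat -mulr_natr; ring.
rewrite big_nat_recr //= subnn.
have cF k' : \sum_(c : F) iota c ^+ k' = iota (\sum_(c : F) c ^+ k').
  by rewrite rmorph_sum; apply: eq_bigr => c _; rewrite rmorphXn.
(* The exponent [M' = M] carries the sum of [c ^ 0], which vanishes; hence chains increase
   strictly. *)
rewrite [X in _ + X](_ : _ = 0) ?addr0; last by rewrite cF sum_expr rmorph0 !mul0r.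
rewrite [RHS]big_mkcond /=; apply: eq_big_nat => M' /andP[_ lt].
rewrite cF sum_expr subn_gt0 lt IHD /jump /=; case: ifP => dv; last by rewrite rmorph0 !mul0r.
case: eqP => [->|_]; first by rewrite rmorph0 mul0r mulr0 mul0r.
rewrite mulr_sumr [in LHS]big_seq [in RHS]big_seq; apply: eq_bigr => l /chains_spec[-> ->].
by rewrite rmorphN1 mulN1r !mulNr.
Qed.

Definition full_chains D m : seq (seq nat) :=
  [seq l | M <- [seq M <- index_iota 0 m.+1 | 'C(m, M)%:R != 0 :> F], l <- chains D M].

Definition full_term m y l : k :=
  iota 'C(m, head 0%N l)%:R * y ^+ (m - head 0%N l) * term l.

Lemma full_chains_uniq D m : uniq (full_chains D m).
Proof.
apply: allpairs_uniq_dep; first by rewrite filter_uniq // iota_uniq.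
  by move=> M _; apply: chains_uniq.
move=> [M1 l1] [M2 l2] /allpairsPdep[x1 [y1 [_ h1 E1]]] /allpairsPdep[x2 [y2 [_ h2 E2]]] /= El.
case: E1 h1 El => -> -> h1 El; case: E2 h2 El => -> -> h2 El.
by move: (chains_spec h1) (chains_spec h2); rewrite El => -[_ ->] [_ ->].
Qed.

Lemma sum_lins_addX D m y :
  \sum_(a <- lins D) (y + a) ^+ m = \sum_(l <- full_chains D m) full_term m y l.
Proof.
rewrite [RHS]big_allpairs_dep [RHS]big_filter [RHS]big_mkcond /=.
under eq_bigr => a _ do rewrite exprDn -(big_mkord xpredT (fun i => (y ^+ (m - i) * a ^+ i) *+ 'C(m, i))).
rewrite exchange_big /=; apply: eq_bigr => M _.
rewrite -[LHS](_ : iota 'C(m, M)%:R * y ^+ (m - M) * \sum_(a <- lins D) a ^+ M = _); last first.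
  by rewrite mulr_sumr; apply: eq_bigr => a _; rewrite rmorph_nat -mulrA mulr_natl.
case: eqP => [->|_]; first by rewrite rmorph0 !mul0r.
rewrite sum_lins_exp mulr_sumr [in LHS]big_seq [in RHS]big_seq.
by apply: eq_bigr => l /chains_spec[_ El]; rewrite /full_term El.
Qed.

Local Notation nth_chain l := (fun i => nth 0%N (rev l) i).

Lemma full_chains_number D m l : l \in full_chains D m ->
  size l = D /\ number_chain p e' D m (nth_chain l).
Proof.
case/allpairsPdep=> M [l' [/[!mem_filter]/andP[Cm _] hl ->]] {l}.
have [sl _] := chains_spec hl; split=> //.
have key : [/\ forall i, (i < D -> #|F|.-1 %| nth 0 (rev l') i)%N,
    forall i, (i.+1 < D -> nth 0 (rev l') i < nth 0 (rev l') i.+1)%N,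
    (0 < D -> 0 < nth 0 (rev l') 0)%N &
    forall i, (i.+1 < D)%N -> digit_le p (nth 0%N (rev l') i) (nth 0%N (rev l') i.+1)].
  elim: D M l' hl sl {Cm} => [|D IHD] M l //= /allpairsPdep[M' [l' [hM' hl ->]]] /= [sl].
  move: hM'; rewrite mem_filter mem_index_iota /jump => /andP[/andP[dv Cb] /andP[_ lt]].
  have [h1 h2 h3 h4] := IHD _ _ hl sl; have [_ hd] := chains_spec hl.
  have nthE i : nth 0%N (rev (M :: l')) i = if (i < D)%N then nth 0%N (rev l') i else if i == D then M else 0%N.
    by rewrite rev_cons nth_rcons size_rev sl.
  have last_hd : (0 < D)%N -> nth 0%N (rev l') D.-1 = M'.
    move=> D0; rewrite nth_rev ?sl ?prednK // subnn nth0; exact: hd.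
  (* Chains start from 0, so divisibility of the jumps gives divisibility of the elements. *)
  have M'dv : (#|F|.-1 %| M')%N.
    case: (posnP D) => [D0|D0]; last by rewrite -last_hd // h1 // prednK.
    by move: hl; rewrite D0 /=; case: eqP => // -> _; rewrite dvdn0.
  have Mdv : (#|F|.-1 %| M)%N by rewrite -(subnK (ltnW lt)) dvdn_add.
  split=> [i|i|_|i]; rewrite !nthE.
  - rewrite ltnS leq_eqVlt => /orP[/eqP->|lt_i]; first by rewrite ltnn eqxx.
    by rewrite lt_i h1.
  - rewrite ltnS => lt_i; rewrite lt_i [(i.+1 < D)%N]ltn_neqAle lt_i andbT.
    case: eqP => [E|ne]; last by rewrite h2 // [(i.+1 < D)%N]ltn_neqAle lt_i andbT; apply/eqP.
    have -> : i = D.-1 by rewrite -E.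
    by rewrite last_hd //; rewrite -E.
  - by case: (posnP D) => [->|D0]; [rewrite eqxx; lia | rewrite h3].
  rewrite ltnS => lt_i; rewrite lt_i [(i.+1 < D)%N]ltn_neqAle lt_i andbT.
  case: eqP => [E|ne]; last by apply: h4; rewrite ltn_neqAle lt_i andbT; apply/eqP.
  have -> : i = D.-1 by rewrite -E.
  by rewrite last_hd; [apply/(binomial_char pcharFp) | rewrite -E].
have [h1 h2 h3 h4] := key; split=> //; first by rewrite -cardF.
move=> D0; rewrite nth_rev ?sl ?prednK // subnn nth0.
by apply/(binomial_char pcharFp); have [_ ->] := chains_spec hl.
Qed.

Lemma number_full_chains D m M : number_chain p e' D m M ->
  exists2 l, l \in full_chains D m & forall i, (i < D)%N -> nth_chain l i = M i.
Proof.
move=> [h1 h2 h3 h4 h5].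
have key d : (d <= D)%N -> exists2 l, l \in chains d (if d is d'.+1 then M d' else 0%N) &
    forall i, (i < d)%N -> nth_chain l i = M i.
  elim: d => [|d IHd] le /=; first by exists [::]; rewrite ?inE.
  have [l hl lM] := IHd (ltnW le); have [sl hd] := chains_spec hl.
  exists (M d :: l).
    apply/allpairsPdep; do 2!eexists; split; last by [].
      2: exact: hl.
    rewrite mem_filter mem_index_iota /jump cardF.
    case: d le {IHd hl lM sl hd l} => [|d] le /=.
      by rewrite subn0 h1 // h3 ?bin0 ?oner_eq0 //; lia.
    rewrite dvdn_sub ?h1 ?h2 ?(ltnW le) //= andbT.
    by apply/(binomial_char pcharFp)/h4.
  move=> i; rewrite rev_cons nth_rcons size_rev sl ltnS leq_eqVlt => /orP[/eqP->|lt].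
    by rewrite ltnn eqxx.
  by rewrite lt lM.
have [l hl lM] := key D (leqnn D); exists l => //.
apply/allpairsPdep; do 2!eexists; split; last by [].
  2: exact: hl.
rewrite mem_filter mem_index_iota /=; case: (D) h5 => [|d] h5.
  by rewrite bin0 oner_eq0.
have h := h5 isT; apply/andP; split; first exact/(binomial_char pcharFp).
by rewrite ltnS (digit_le_leq (prime_gt1 (pcharf_prime pcharFp)) h).
Qed.

(** * Valuations of the terms and of the power sums *)

Section Weighted.

Variables (v : k -> int) (wt : nat -> nat).
Hypothesis vP : is_valuation v.
Hypothesis v_iota : forall c : F, c != 0 -> v (iota c) = 0.
Hypothesis X_neq0 : forall i, X i != 0.
Hypothesis vX : forall i, v (X i) = - (wt i)%:Z.
Hypothesis wt_lt : forall i, (wt i < wt i.+1)%N.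

Let delta i := (wt i.+1 - wt i)%N.

Lemma val_ge_lins D a : a \in lins D -> val_ge v (1 - (wt D)%:Z) a.
Proof.
clear pcharFp cardF.
elim: D a => [|D IHD] a /=; first by rewrite inE => /eqP->; left.
case/allpairsP=> -[b c] /= [/IHD hb _ ->]; apply: val_geD => //.
  by apply: val_ge_le hb; have := wt_lt D; lia.
have [->|c0] := eqVneq c 0; first by left; rewrite rmorph0 mul0r.
by right; rewrite (valrM vP) ?fmorph_eq0 // v_iota // vX; have := wt_lt D; lia.
Qed.

Lemma number_cost_cons D M l : size l = D ->
  number_cost delta D.+1 (nth_chain (M :: l)) = (number_cost delta D (nth_chain l) + delta D * M)%N.
Proof.
move=> sl; rewrite /number_cost big_ord_recr /= rev_cons nth_rcons size_rev sl ltnn eqxx.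
by congr addn; apply: eq_bigr => i _; rewrite nth_rcons size_rev sl ltn_ord.
Qed.

(** Summation by parts of the exponents [M_i - M_(i-1)] against the degrees [wt i]. *)
Lemma val_term D M l : l \in chains D M ->
  term l != 0 /\ v (term l) = (number_cost delta D (nth_chain l))%:Z - (wt D * M)%:Z.
Proof.
elim: D M l => [|D IHD] M l /=.
  case: eqP => [->|_] //; rewrite inE => /eqP->; split; first exact: oner_neq0.
  by rewrite (valr1 vP) /number_cost big_ord0 muln0.
case/allpairsPdep=> M' [l' [hM' hl ->]] {l}; have [sl hd] := chains_spec hl.
move: hM'; rewrite mem_filter mem_index_iota => /andP[/andP[_ Cb] /andP[_ lt]].
have [t0 vt] := IHD _ _ hl; rewrite number_cost_cons //= hd sl.
have i0 : iota 'C(M, M')%:R != 0 by rewrite fmorph_eq0.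
split; first by rewrite !mulf_neq0 ?oppr_eq0 ?expf_neq0.
rewrite !(valrM vP) ?mulf_neq0 ?oppr_eq0 ?expf_neq0 // (valrN vP) v_iota // (valrX vP) vX vt.
rewrite /delta -mulr_natr natz -(subnK (ltnW lt)) -(subnK (ltnW (wt_lt D))).
move: (number_cost _ _ _) (M - M')%N (wt D.+1 - wt D)%N => c d w'.
by rewrite !addnK !(PoszD, PoszM); ring.
Qed.

Lemma val_full_term D m l : l \in full_chains D m ->
  full_term m (X D) l != 0 /\
  v (full_term m (X D) l) = (number_cost delta D (nth_chain l))%:Z - (wt D * m)%:Z.
Proof.
case/allpairsPdep=> M [l' [hM hl ->]] {l}; have [sl hd] := chains_spec hl.
move: hM; rewrite mem_filter mem_index_iota ltnS => /andP[Cb /andP[_ le]].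
have [t0 vt] := val_term hl; rewrite /full_term hd.
have i0 : iota 'C(m, M)%:R != 0 by rewrite fmorph_eq0.
split; first by rewrite !mulf_neq0 ?expf_neq0.
rewrite !(valrM vP) ?mulf_neq0 ?expf_neq0 // v_iota // (valrX vP) vX vt.
by rewrite -mulr_natr natz; nia.
Qed.

Definition optimal_numbers D n M := exists N0, (n < p ^ N0)%N /\
  forall N, (N0 <= N)%N -> number_chain p e' D (p ^ N - n.+1) M /\
    forall M', number_chain p e' D (p ^ N - n.+1) M' ->
      (number_cost delta D M <= number_cost delta D M')%N /\
      (number_cost delta D M' = number_cost delta D M ->
       forall i, (i < D)%N -> M' i = M i).

(** Terms correspond to number chains, so the unique chain of least cost gives the one term of
    strictly least valuation. *)
Lemma val_sum_lins_exp D n M : optimal_numbers D n M ->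
  exists N0, forall N, (N0 <= N)%N -> (n < p ^ N)%N /\
    let S := \sum_(a <- lins D) (X D + a) ^+ (p ^ N - n.+1) in
    S != 0 /\ v S = (number_cost delta D M)%:Z - (wt D * (p ^ N - n.+1))%:Z.
Proof.
have p1 : (1 < p)%N := prime_gt1 (pcharf_prime pcharFp).
case=> N0 [hN0 opt]; exists N0 => N le; split.
  by apply: leq_trans hN0 _; rewrite leq_exp2l.
have [MP Mmin] := opt N le; have [l0 hl0 l0M] := number_full_chains MP.
have cost0 : number_cost delta D (nth_chain l0) = number_cost delta D M.
  by apply: eq_bigr => i _; rewrite l0M.
have [t0 vt0] := val_full_term hl0.
rewrite /= sum_lins_addX -cost0 -vt0; apply: val_sum_dominant => //.
  exact: full_chains_uniq.
move=> l hl ne; have [t1 vt1] := val_full_term hl; right; rewrite vt0 vt1 cost0.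
have [sl lP] := full_chains_number hl; have [le1 eq1] := Mmin _ lP.
have neq : number_cost delta D (nth_chain l) <> number_cost delta D M.
  move=> /eq1 h; case/eqP: ne; have [sl0 _] := full_chains_number hl0.
  rewrite -[l]revK -[l0]revK; congr rev; apply: (@eq_from_nth _ 0%N).
    by rewrite !size_rev sl sl0.
  by move=> i; rewrite size_rev sl => lt; rewrite h // l0M.
lia.
Qed.

(** With [P = p ^ N], one has [(X D + a) ^ P = X D ^ P + a ^ P]; passing to the exponent [P - n.+1]
    and dividing by [X D ^ P] changes a summand by a relative error [a ^ P / X D ^ P], of valuation
    at least [P]. *)
Lemma val_power_sum D n M : optimal_numbers D n M ->
  let H := \sum_(a <- lins D) ((X D + a) ^+ n.+1)^-1 in
  H != 0 /\ v H = (n.+1 * wt D + number_cost delta D M)%:Z.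
Proof.
move=> /val_sum_lins_exp[N0 h] H.
have p1 : (1 < p)%N := prime_gt1 (pcharf_prime pcharFp).
(* Taking [N >= C] makes [P] exceed the cost, so the error lies beyond the leading valuation. *)
pose C := number_cost delta D M; pose N := maxn N0 C; pose P := (p ^ N)%N.
have [nP] := h N (leq_maxl _ _); set m := (P - n.+1)%N; set S := \sum_(a <- _) _ => -[S0 vS].
have CP : (C < P)%N by apply: leq_trans (ltn_expl C p1) _; rewrite leq_exp2l // leq_maxr.
have pk : p \in [pchar k] by rewrite (fmorph_pchar iota).
have u0 a : a \in lins D -> X D + a != 0 /\ v (X D + a) = - (wt D)%:Z.
  move=> /val_ge_lins ha; rewrite -vX; apply: (val_addl vP) => //.
  by apply: val_ge_le ha; rewrite vX; lia.
have XP0 : (X D ^+ P)^-1 != 0 by rewrite invr_neq0 ?expf_neq0.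
have vXP : v (X D ^+ P)^-1 = (wt D * P)%:Z.
  by rewrite (valrV vP) (valrX vP) vX -mulr_natr natz; lia.
have SX0 : S * (X D ^+ P)^-1 != 0 by rewrite mulf_neq0.
have vSX : v (S * (X D ^+ P)^-1) = (n.+1 * wt D + C)%:Z.
  by rewrite (valrM vP) // vS vXP -/P -/m /C /m; nia.
suff err : val_ge v ((n.+1 * wt D + C)%:Z + 1) (H - S * (X D ^+ P)^-1).
  have := @val_addl _ _ vP _ (H - S * (X D ^+ P)^-1) SX0.
  by rewrite (addrC (S * _)) subrK vSX; apply.
rewrite mulr_suml -sumrB; apply: (val_ge_sum vP) => a ha _.
have [a0 va] := u0 a ha; have hv := val_ge_lins ha.
have -> : ((X D + a) ^+ n.+1)^-1 - (X D + a) ^+ m / X D ^+ P =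
    - ((X D + a) ^+ m / (X D + a) ^+ P / X D ^+ P * a ^+ P).
  have EP : (X D + a) ^+ P = X D ^+ P + a ^+ P.
    by rewrite exprDn_pchar // pnatX pnatE ?(pcharf_prime pk) // pk.
  have -> : ((X D + a) ^+ n.+1)^-1 = (X D + a) ^+ m / (X D + a) ^+ P.
    apply: (mulfI (expf_neq0 n.+1 a0)); rewrite divff ?expf_neq0 //.
    by rewrite mulrA -exprD subnKC // divff ?expf_neq0.
  have -> : a ^+ P = (X D + a) ^+ P - X D ^+ P by rewrite EP addrC addKr.
  have := expf_neq0 P a0; have := expf_neq0 P (X_neq0 D).
  move: (_ ^+ m) ((_ + _) ^+ P) (X D ^+ P) => x y z z0 y0; field.
  by rewrite z0 y0.
apply: (val_geN vP).
apply: (@val_ge_le _ _ _ (- (wt D)%:Z *+ m + (wt D)%:Z *+ P + (wt D)%:Z *+ P + (1 - (wt D)%:Z) *+ P)).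
  have PE : P = (m + n.+1)%N by rewrite /m subnK.
  clear -PE CP; move: (C) (m) (P) PE CP => c m' _ -> lt.
  rewrite !pmulrn !mulrzz; apply: le_trans (_ : (n.+1 * wt D)%:Z + (m' + n.+1)%N%:Z <= _).
    by rewrite PoszD -addrA lerD2l; lia.
  by rewrite !(PoszD, PoszM) le_eqVlt; apply/orP; left; apply/eqP; ring.
apply: (val_geM vP); last exact: val_geX.
apply: (val_geM vP); last by right; rewrite vXP -mulr_natr natz; lia.
apply: (val_geM vP); first by apply: val_geX => //; right; rewrite va.
by right; rewrite (valrV vP) (valrX vP) va mulNrn opprK.
Qed.

Hypothesis delta0 : (delta 0 <= 2)%N.
Hypothesis deltaS : forall i, (delta i.+1 <= 1)%N.

Lemma val_power_sum_lt s : (0 < s)%N ->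
  let H D := \sum_(a <- lins D) ((X D + a) ^+ s)^-1 in
  forall D, [/\ H D != 0, H D.+1 != 0 & v (H D) < v (H D.+1)].
Proof.
case: s => // n _ H D; have p1 : (1 < p)%N := prime_gt1 (pcharf_prime pcharFp).
have delta_gt0 i : (0 < delta i)%N by rewrite subn_gt0.
have opt D' := number_chain_unique e' n p1 delta0 deltaS delta_gt0 D'.
have [M [N0 [hN0 optM]]] := opt D; have [M' [N1 [hN1 optM']]] := opt D.+1.
have [H0 vH] := val_power_sum (ex_intro _ N0 (conj hN0 optM)).
have [H1 vH'] := val_power_sum (ex_intro _ N1 (conj hN1 optM')).
split=> //; rewrite vH vH' ltz_nat.
have [_ Mmin] := optM _ (leq_maxl N0 N1).
have [M'P _] := optM' _ (leq_maxr N0 N1).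
have MP : number_chain p e' D (p ^ maxn N0 N1 - n.+1) M'.
  have Mle := fun i => @number_chain_le p e' p1 D.+1 _ M' i M'P; case: M'P => [h1 h2 h3 h4 _]; split.
  - by move=> i lt; apply: h1; apply: leqW.
  - by move=> i lt; apply: h2; apply: leqW.
  - by move=> _; apply: h3.
  - by move=> i lt; apply: h4; apply: leqW.
  by move=> D0; apply: Mle; rewrite prednK // leqW.
have [le _] := Mmin _ MP.
have : (number_cost delta D M' <= number_cost delta D.+1 M')%N.
  by rewrite /number_cost [X in (_ <= X)%N]big_ord_recr leq_addr.
by have := wt_lt D; move: le; rewrite /=; nia.
Qed.

End Weighted.

End Expansion.

(** * Degrees and monic elements *)

Section FunctionField.

Variables (F : finFieldType) (k : fieldType) (iota : {rmorphism F -> k}).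

Lemma val_iota_ge (P : place iota) c : val_ge P 0 (iota c).
Proof.
have [->|c0] := eqVneq c 0; first by left; rewrite rmorph0.
by right; rewrite pval_const.
Qed.

Lemma val_ge_iotaM (P : place iota) n c x : val_ge P n x -> val_ge P n (iota c * x).
Proof.
by move=> h; rewrite -[n]add0r; apply: (val_geM (pval_valuation P)) => //; apply: val_iota_ge.
Qed.

Lemma RR_comb (D : divisor iota) n (b : 'I_n -> k) (c : {ffun 'I_n -> F}) :
  (forall i, RR_space D (b i)) -> RR_space D (\sum_(i < n) iota (c i) * b i).
Proof.
move=> hb P; apply: (val_ge_sum (pval_valuation P)) => i _ _.
by apply: val_ge_iotaM; apply: hb.
Qed.

Lemma RR_inj (D : divisor iota) n (b : 'I_n -> k) (c c' : {ffun 'I_n -> F}) :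
  (forall i, RR_space D (b i)) ->
  (forall y, RR_space D y ->
     exists! c : {ffun 'I_n -> F}, [set 0]%classic (y - \sum_(i < n) iota (c i) * b i)) ->
  \sum_(i < n) iota (c i) * b i = \sum_(i < n) iota (c' i) * b i -> c = c'.
Proof.
move=> hb h E; have [c0 [_ cu]] := h _ (RR_comb c hb).
by rewrite -(cu c) ?(cu c') //= ?E subrr.
Qed.

Hypotheses (hk : is_function_field iota) (hg : has_genus iota 1).
Variable oo : place iota.
Hypothesis hoo : place_degree oo = 1%N.

Local Notation A := (regular_away oo).
Let vP := pval_valuation oo.

(** The genus bound is applied to [N] times [oo], a divisor of degree [N] because [oo] is
    rational. *)
Lemma ell_ge N : (0 < N)%N -> exists n (b : 'I_n -> k), (N <= n)%N /\
  (forall y, A y -> val_ge oo (- N%:Z) y -> exists c : {ffun 'I_n -> F}, y = \sum_(i < n) iota (c i) * b i) /\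
  (forall c : {ffun 'I_n -> F}, A (\sum_(i < n) iota (c i) * b i) /\
     val_ge oo (- N%:Z) (\sum_(i < n) iota (c i) * b i)) /\
  injective (fun c : {ffun 'I_n -> F} => \sum_(i < n) iota (c i) * b i).
Proof.
move=> N0; pose D : divisor iota := [fsfun [fsfun of _ => 0] with oo |-> N%:Z].
have DE P : D P = if P == oo then N%:Z else 0 by rewrite fsfun_withE fsfun0E.
have degD : div_degree D = N%:Z.
  rewrite /div_degree finsupp_with finsupp0 fsetU0.
  have -> : (N%:Z == 0) = false by lia.
  by rewrite big_seq_fset1 DE eqxx hoo mulr1.
have lD : (N <= ell D)%N by have [h _] := hg; have := h D; rewrite degD; lia.
have RRE y : RR_space D y <-> A y /\ val_ge oo (- N%:Z) y.
  split=> [h|[h1 h2] P].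
    split=> [P ne|]; last by have := h oo; rewrite DE eqxx.
    by have := h P; rewrite DE; case: eqP => // _; rewrite oppr0.
  by rewrite DE; case: eqP => [->//|ne]; rewrite oppr0; apply: h1.
(* Since [N > 0], the dimension is not the default value 0 and a basis exists. *)
move: lD; rewrite /ell /qdim; case: xgetP => [n _ [b [hb hu]]|_]; last by rewrite leqn0 => /eqP E; rewrite E in N0.
move=> le; exists n, b; split=> //; split; last split.
- move=> y Ay vy; have /hu[c [hc _]] : RR_space D y by apply/RRE.
  by exists c; apply/eqP; rewrite -subr_eq0; apply/eqP.
- by move=> c; apply/RRE; apply: RR_comb.
by move=> c c' /(RR_inj hb hu).
Qed.

Lemma A_0 : A 0. Proof. by move=> P _; left. Qed.
Lemma A_1 : A 1. Proof. by move=> P _; right; rewrite (valr1 (pval_valuation P)). Qed.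
Lemma A_M x y : A x -> A y -> A (x * y).
Proof.
by move=> hx hy P ne; rewrite -[0]addr0; apply: (val_geM (pval_valuation P)); [apply: hx | apply: hy].
Qed.
Lemma A_D x y : A x -> A y -> A (x + y).
Proof. by move=> hx hy P ne; apply: (val_geD (pval_valuation P)); [apply: hx | apply: hy]. Qed.
Lemma A_N x : A x -> A (- x).
Proof. by move=> hx P ne; apply: (val_geN (pval_valuation P)); apply: hx. Qed.
Lemma A_Z c x : A x -> A (iota c * x).
Proof. by move=> hx P ne; apply: val_ge_iotaM; apply: hx. Qed.

Lemma A_X x n : A x -> A (x ^+ n).
Proof. by move=> hx; elim: n => [|n IHn]; rewrite ?exprS; [exact: A_1 | apply: A_M]. Qed.

(** The powers of an element of [A] with a zero at [oo] stay in a finite space, so two of them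
    coincide; the element is algebraic, hence constant, and has valuation 0. *)
Lemma A_val_le0 a : A a -> a != 0 -> oo a <= 0.
Proof.
move=> Aa a0; rewrite leNgt; apply/negP => va.
have [n [b [_ [hb _]]]] := ell_ge (isT : (0 < 1)%N).
have pw i : exists c : {ffun 'I_n -> F}, a ^+ i = \sum_(i < n) iota (c i) * b i.
  apply: hb; first exact: A_X.
  by right; rewrite (valrX vP) (@le_trans _ _ 0) // mulrn_wge0 // ltW.
have [c cE] := choice pw.
have [i [i' [lt E]]] : exists i i' : nat, (i < i')%N /\ a ^+ i = a ^+ i'.
  have : ~ injective (fun i : 'I_(#|{ffun 'I_n -> F}|.+1) => c i).
    by move/leq_card; rewrite card_ord ltnn.
  move=> /existsNP[i] /existsNP[i'] /not_implyP[E ne].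
  have ne' : (i : nat) <> i' by move=> h; apply: ne; apply: ord_inj.
  case: (ltngtP i i') => // lt; [exists i, i' | exists i', i] => //; by rewrite !cE E.
have alg : algebraicOver iota a.
  exists ('X^i' - 'X^i); last by rewrite rmorphB /= !map_polyXn rootE !hornerE E subrr.
  rewrite -size_poly_eq0 size_polyDl ?size_polyXn // size_polyN size_polyXn //.
have [c0 Ec] := hk.2 a alg.
by move: va; rewrite Ec pval_const // -(fmorph_eq0 iota) -Ec.
Qed.

(** The residue field is one-dimensional over [F]; dividing by the coordinate [c1] of 1 turns
    coordinates into constants. *)
Lemma residue y : val_ge oo 0 y -> exists c : F, val_ge oo 1 (y - iota c).
Proof.
move=> hy; have : qdim iota (val_ge oo 0) (val_ge oo 1) = 1%N := hoo.
rewrite /qdim; case: xgetP => // n _ [b [hb hu]] n1; move: b hb hu; rewrite n1 => b hb hu.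
have one x : val_ge oo 0 x -> exists c, val_ge oo 1 (x - iota c * b ord0).
  by move=> /hu[c [hc _]]; exists (c ord0); rewrite big_ord1 in hc.
have [c1 h1] : exists c, val_ge oo 1 (1 - iota c * b ord0).
  by apply: one; right; rewrite (valr1 vP).
have c10 : c1 != 0.
  apply/eqP=> E; move: h1; rewrite E rmorph0 mul0r subr0 => /(val_geW (oner_neq0 _)).
  by rewrite (valr1 vP).
have [c hc] := one y hy; exists (c / c1).
have -> : y - iota (c / c1) = (y - iota c * b ord0) - iota (c / c1) * (1 - iota c1 * b ord0).
  have -> : iota c = iota (c / c1) * iota c1 by rewrite -rmorphM divfK.
  by ring.
by apply: (val_geB vP) => //; apply: val_ge_iotaM.
Qed.

Lemma lead_coef_exists x y : x != 0 -> y != 0 -> oo x = oo y ->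
  exists2 c : F, c != 0 & val_ge oo (oo x + 1) (y - iota c * x).
Proof.
move=> x0 y0 E; have [|c hc] := @residue (y / x).
  by right; rewrite (valrM vP) ?invr_neq0 // (valrV vP) E subrr.
have hv : val_ge oo (oo x + 1) (y - iota c * x).
  have -> : y - iota c * x = x * (y / x - iota c) by field.
  by apply: (val_geM vP) => //; right.
exists c => //; apply/eqP => c0; move: hv; rewrite c0 rmorph0 mul0r subr0.
by move=> /(val_geW y0); rewrite E; lia.
Qed.

Definition pole_degree n := exists a, [/\ A a, a != 0 & oo a = - n%:Z].

Lemma pole_degree0 : pole_degree 0.
Proof. by exists 1; split; [exact: A_1 | exact: oner_neq0 | rewrite (valr1 vP)]. Qed.

Lemma pole_degreeD m n : pole_degree m -> pole_degree n -> pole_degree (m + n).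
Proof.
move=> [a [Aa a0 va]] [b [Ab b0 vb]]; exists (a * b); split; first exact: A_M.
  exact: mulf_neq0.
by rewrite (valrM vP) // va vb PoszD opprD.
Qed.

Lemma A_small n : exists L : seq k,
  (forall a, A a -> val_ge oo (1 - n%:Z) a -> a \in L) /\
  size L = (#|F| ^ count (fun i => `[<pole_degree i>]) (seq.iota 0 n))%N.
Proof.
elim: n => [|n [L [hL sL]]].
  exists [:: 0]; split=> // a Aa ha; rewrite inE; apply/eqP; apply: contrapT => /eqP a0.
  by have := A_val_le0 Aa a0; move: ha => /(val_geW a0); lia.
rewrite -addn1 iotaD count_cat /= addn0; case: asboolP => [[x [Ax x0 vx]]|hn]; last first.
  exists L; split; last by rewrite addn0.
  move=> a Aa ha; have [->|a0] := eqVneq a 0; first by apply: hL; [exact: A_0 | left].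
  apply: hL => //; right; have := val_geW a0 ha.
  suff : oo a != - n%:Z by lia.
  by apply/eqP => E; apply: hn; exists a.
exists [seq a + iota c * x | a <- L, c <- enum F]; split; last first.
  by rewrite size_allpairs sL -cardE expnD expn1.
move=> a Aa ha.
have [c hc] : exists c, val_ge oo (1 - n%:Z) (a - iota c * x).
  have [->|a0] := eqVneq a 0; first by exists 0; left; rewrite rmorph0 mul0r subr0.
  have := val_geW a0 ha; case: (eqVneq (oo a) (- n%:Z)) => [E|ne] le.
    have [|c _] := lead_coef_exists x0 a0; first by rewrite vx E.
    by rewrite vx => h; exists c; apply: val_ge_le h; lia.
  by exists 0; rewrite rmorph0 mul0r subr0; right; lia.
apply/allpairsP; exists (a - iota c * x, c) => /=; split; last by rewrite subrK.
  by apply: hL => //; apply: A_D => //; apply: A_N; apply: A_Z.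
by rewrite mem_enum.
Qed.

(** The [#|F| ^ n] elements with pole order at most [N], where [n >= N], are contained in the list
    of [A_small], whose size is a power of [#|F|] given by the count. *)
Lemma count_pole_degree N : (0 < N)%N ->
  (N <= count (fun i => `[<pole_degree i>]) (seq.iota 0 N.+1))%N.
Proof.
move=> N0; have [n [b [le [_ [hc inj]]]]] := ell_ge N0.
apply: leq_trans le _; have [L [hL sL]] := A_small N.+1.
rewrite -(leq_exp2l _ _ (finNzRing_gt1 F)) -sL.
have <- : size [seq \sum_(i < n) iota (c i) * b i | c : {ffun 'I_n -> F} <- enum {ffun 'I_n -> F}] = (#|F| ^ n)%N.
  by rewrite size_map -cardE card_ffun card_ord.
apply: uniq_leq_size; first by rewrite map_inj_uniq ?enum_uniq.
move=> _ /mapP[c _ ->]; have [h1 h2] := hc c; apply: hL => //.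
by apply: val_ge_le h2; lia.
Qed.

(** Two gaps [i < j] would leave only [j - 1] degrees up to [j]. So either 1 is a degree and there
    is no gap, or 1 is the only gap. *)
Lemma pole_degreeP : exists g, (g <= 1)%N /\
  forall n, pole_degree n <-> (n = 0%N \/ (g < n)%N).
Proof.
have gaps i j : (i < j)%N -> pole_degree i \/ pole_degree j.
  move=> lt; apply: contrapT => /not_orP[ni nj].
  have := @count_pole_degree j (leq_ltn_trans (leq0n i) lt).
  rewrite -addn1 iotaD count_cat /= (asboolF nj) addn0.
  have := subnKC (ltnW lt); rewrite -[(j - i)%N]prednK ?subn_gt0 // => <-.
  rewrite iotaD count_cat /= add0n (asboolF ni) add0n.
  have := count_size (fun i => `[<pole_degree i>]) (seq.iota 0 i).
  have := count_size (fun i => `[<pole_degree i>]) (seq.iota i.+1 (j - i).-1).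
  by rewrite !size_iota; lia.
have [h1|h1] := pselect (pole_degree 1).
  exists 0%N; split=> // n; split=> [_|_]; first by lia.
  by elim: n => [|n IHn]; [exact: pole_degree0 | rewrite -addn1; apply: pole_degreeD].
exists 1%N; split=> // n; split=> [hn|].
  by case: n hn => [|[|n]] //; [left | right].
by case=> [->|lt]; [exact: pole_degree0 | case: (gaps _ _ lt)].
Qed.

Variable sgn : k -> F.
Hypothesis hsgn : is_sign oo sgn.

(** The sign is trivial close enough to 1; the [p ^ N]-th power of a 1-unit is that close, and
    raising to the power [p ^ N] is injective on [F]. *)
Lemma sgn_unit u : u != 0 -> val_ge oo 1 (u - 1) -> sgn u = 1.
Proof.
move=> u0 hu; have [sgn0 sgnM _ [n hn]] := hsgn.
have [p p_pr pF] := finPcharP F.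
have pk : p \in [pchar k] by rewrite (fmorph_pchar iota).
pose N := `|n|%N.
have sgnX m : sgn (u ^+ m) = sgn u ^+ m.
  elim: m => [|m IHm]; first by apply: hn; [exact: oner_neq0 | left; rewrite expr0 subrr].
  by rewrite !exprS sgnM ?expf_neq0 // IHm.
have Frob (R : comNzRingType) : p \in [pchar R] -> forall x : R, (x - 1) ^+ (p ^ N) = x ^+ (p ^ N) - 1.
  move=> pR x; have pn : [pchar R].-nat (p ^ N)%N by rewrite pnatX pnatE // pR.
  have := exprDn_pchar (x - 1) 1 pn; rewrite subrK expr1n => ->.
  by rewrite addrK.
have : sgn (u ^+ (p ^ N)) = 1.
  apply: hn; first exact: expf_neq0.
  rewrite -Frob //; apply: val_ge_le (val_geX vP (p ^ N) hu).
  have : (N < p ^ N)%N by rewrite ltn_expl // prime_gt1.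
  by rewrite pmulrn mulrzz mul1r /N; lia.
rewrite sgnX => E; apply/eqP; rewrite -subr_eq0.
by have := Frob _ pF (sgn u); rewrite E subrr => /eqP; rewrite expf_eq0 => /andP[].
Qed.

Lemma sgn_close x y : x != 0 -> val_ge oo (oo x + 1) (y - x) -> y != 0 /\ sgn y = sgn x.
Proof.
move=> x0 hy; have [_ sgnM _ _] := hsgn.
have [y0 _] := val_addl vP x0 hy; rewrite addrC subrK in y0; split=> //.
have u0 : y / x != 0 by rewrite mulf_neq0 ?invr_neq0.
suff su : sgn (y / x) = 1 by rewrite -[y in LHS](divfK x0) sgnM // su mul1r.
apply: sgn_unit => //; have -> : y / x - 1 = (y - x) * x^-1 by field.
have -> : 1 = (oo x + 1) - oo x by lra.
by apply: (val_geM vP) => //; right; rewrite (valrV vP).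
Qed.

Lemma monic_basis : exists (X : nat -> k) (wt : nat -> nat),
  [/\ forall i, is_monic oo sgn (X i), forall i, oo (X i) = - (wt i)%:Z,
      [/\ forall i, (wt i < wt i.+1)%N, (wt 1 - wt 0 <= 2)%N &
         forall i, (wt i.+2 - wt i.+1 <= 1)%N],
      forall a, is_monic oo sgn a -> exists D, oo a = - (wt D)%:Z &
      forall D, uniq (lins iota X D) /\
        forall a, (is_monic oo sgn a /\ oo a = - (wt D)%:Z) <-> a - X D \in lins iota X D].
Proof.
have [g [g1 degP]] := pole_degreeP.
have [sgn0 sgnM sgnC _] := hsgn.
(* The degrees in increasing order are 0, [g.+1], [g.+2], and so on. *)
pose wt i := (if i is 0 then 0 else i + g)%N.
have exX i : exists x, is_monic oo sgn x /\ oo x = - (wt i)%:Z.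
  have : pole_degree (wt i) by apply/degP; rewrite /wt; case: i => [|i]; lia.
  case=> x [Ax x0 vx]; exists (iota (sgn x)^-1 * x).
  have s0 := sgn0 _ x0; have i0 : iota (sgn x)^-1 != 0 by rewrite fmorph_eq0 invr_eq0.
  split; last by rewrite (valrM vP) // pval_const ?invr_eq0 // add0r.
  split; [exact: A_Z | exact: mulf_neq0 | by rewrite sgnM // sgnC ?invr_eq0 // mulVf].
have [X XP] := choice exX; exists X, wt.
have Xm i : is_monic oo sgn (X i) := (XP i).1; have vX i := (XP i).2.
have XA i : A (X i) by case: (Xm i).
have X0 i : X i != 0 by case: (Xm i).
have wt_lt i : (wt i < wt i.+1)%N by rewrite /wt; case: i => [|i]; lia.
have A_deg a : A a -> a != 0 -> exists D, oo a = - (wt D)%:Z.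
  move=> Aa a0; have va : oo a = - `|oo a|%N%:Z by have := A_val_le0 Aa a0; lia.
  have : pole_degree `|oo a|%N by exists a.
  move=> /degP[E|lt]; first by exists 0%N; rewrite va E.
  move: va lt; move: (`|oo a|%N) => n va lt; exists (n - g)%N.
  by rewrite va /wt; case E: (n - g)%N => [|d]; lia.
have linsA D a : a \in lins iota X D -> A a.
  elim: D a => [|D IHD] a /=; first by rewrite inE => /eqP->; exact: A_0.
  by case/allpairsP=> -[b c] /= [/IHD hb _ ->]; apply: A_D => //; apply: A_Z.
have [p p_pr pF] := finPcharP F.
have lins_val D a : a \in lins iota X D -> val_ge oo (1 - (wt D)%:Z) a.
  by apply: (val_ge_lins vP (@pval_const _ _ _ oo) X0 vX wt_lt).
have linsP D a : A a -> val_ge oo (1 - (wt D)%:Z) a -> a \in lins iota X D.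
  elim: D a => [|D IHD] a Aa ha /=.
    rewrite inE; apply/eqP; apply: contrapT => /eqP a0.
    by have := A_val_le0 Aa a0; move: ha => /(val_geW a0); rewrite /wt; lia.
  have [c hc] : exists c, val_ge oo (1 - (wt D)%:Z) (a - iota c * X D).
    have [->|a0] := eqVneq a 0; first by exists 0; left; rewrite rmorph0 mul0r subr0.
    have := val_geW a0 ha; case: (eqVneq (oo a) (- (wt D)%:Z)) => [E|ne] le.
      have [|c _] := lead_coef_exists (X0 D) a0; first by rewrite vX E.
      by rewrite vX => h; exists c; apply: val_ge_le h; lia.
    exists 0; rewrite rmorph0 mul0r subr0; right.
    have [D' E] := A_deg a Aa a0; rewrite E in ne le *.
    have : (wt D' < wt D)%N; last by lia.
    have wt_le i j : (i <= j)%N -> (wt i <= wt j)%N by rewrite /wt; case: i; case: j => //= *; lia.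
    case: (ltngtP D' D) => [lt|gt|E']; last by rewrite E' eqxx in ne.
      by apply: leq_trans (wt_lt D') _; apply: wt_le.
    by have := wt_le _ _ gt; lia.
  apply/allpairsP; exists (a - iota c * X D, c) => /=; split; last by rewrite subrK.
    by apply: IHD => //; apply: A_D => //; apply: A_N; apply: A_Z.
  by rewrite mem_enum.
split=> //.
- by split=> // i; rewrite /wt; lia.
- by move=> a [Aa a0 _]; apply: A_deg.
move=> D; split.
  elim: D => [//|D IHD] /=; apply: allpairs_uniq => //; first exact: enum_uniq.
  move=> [b c] [b' c'] /allpairsP[[x y] /= [hx _ [-> ->]]] /allpairsP[[x' y'] /= [hx' _ [-> ->]]] /= E.
  have E' : iota (y - y') * X D = x' - x.
    by rewrite rmorphB -[x'](addrK (iota y' * X D)) -E; ring.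
  have [Ey|ne] := eqVneq y y'.
    by move: E; rewrite Ey => /addIr->.
  have d0 : y - y' != 0 by rewrite subr_eq0.
  have : val_ge oo (1 - (wt D)%:Z) (iota (y - y') * X D).
    by rewrite E'; apply: (val_geB vP); apply: lins_val.
  have i0 : iota (y - y') != 0 by rewrite fmorph_eq0.
  move/(val_geW (mulf_neq0 i0 (X0 D))); rewrite (valrM vP) // pval_const // vX.
  by clear; lia.
move=> a; split.
  case=> -[Aa a0 sa] va; apply: linsP.
    by apply: A_D => //; apply: A_N.
  (* The leading coefficient of [a] relative to [X D] is 1, because both are monic. *)
  have [|c c0] := lead_coef_exists (X0 D) a0; first by rewrite vX va.
  rewrite vX => hc; have cX0 : iota c * X D != 0 by rewrite mulf_neq0 ?fmorph_eq0.
  have [_] : a != 0 /\ sgn a = sgn (iota c * X D).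
    apply: sgn_close => //.
    by rewrite (valrM vP) ?fmorph_eq0 // pval_const // vX add0r.
  have [_ _ sX] := Xm D; rewrite sa sgnM ?fmorph_eq0 // sgnC // sX mulr1 => E.
  by move: hc; rewrite -E rmorph1 mul1r addrC.
move=> ha; have hv := lins_val _ _ ha.
have hv' : val_ge oo (oo (X D) + 1) (a - X D) by rewrite vX addrC.
have [a0 sa] := sgn_close (X0 D) hv'.
have [_ _ sX] := Xm D; split; last first.
  by have [_] := val_addl vP (X0 D) hv'; rewrite (addrC (X D)) subrK vX.
split=> //; last by rewrite sa.
by rewrite -(subrK (X D) a); apply: A_D => //; apply: linsA ha.
Qed.

End FunctionField.

(** * Multiple zeta values *)

Section MultipleZeta.

Variables (F : finFieldType) (k : fieldType) (iota : {rmorphism F -> k}).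
Variables (oo : place iota) (sgn : k -> F).
Variables (K : fieldType) (j : {rmorphism k -> K}) (w : K -> int).
Hypothesis hK : is_completion oo j w.
Variables (wt : nat -> nat) (Mo : nat -> seq k).
Hypothesis wt_lt : forall D, (wt D < wt D.+1)%N.
Hypothesis Mo_uniq : forall D, uniq (Mo D).
Hypothesis MoP : forall D a, is_monic oo sgn a /\ oo a = - (wt D)%:Z <-> a \in Mo D.
Hypothesis monic_deg : forall a, is_monic oo sgn a -> exists D, oo a = - (wt D)%:Z.

Local Notation H D s := (\sum_(a <- Mo D) (a ^+ s)^-1).
Hypothesis H_neq0 : forall s D, (0 < s)%N -> H D s != 0.
Hypothesis H_lt : forall s D, (0 < s)%N -> oo (H D s) < oo (H D.+1 s).

Variables (r : nat) (s : 'I_r -> nat).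
Hypothesis s_gt0 : forall i, (0 < s i)%N.

Let wP : is_valuation w. Proof. by case: hK. Qed.
Let wj x : w (j x) = oo x. Proof. by case: hK. Qed.
Let vP := pval_valuation oo.

Local Notation index := (mzv_index oo sgn (r := r)).
Local Notation mterm := (mzv_term j s).

Lemma wt_ge D : (D <= wt D)%N.
Proof. by elim: D => // D IHD; apply: leq_trans (wt_lt D). Qed.

Lemma wt_ltn D D' : (wt D < wt D')%N = (D < D')%N.
Proof.
have mono := homo_ltn (fun x y z => @ltn_trans x y z) wt_lt.
case: (ltngtP D D') => [/mono//|/mono lt|->]; last by rewrite ltnn.
by rewrite ltnNge ltnW.
Qed.

Definition lev (a : k) : nat := xget 0%N [set D | oo a = - (wt D)%:Z]%classic.

Lemma levE a D : oo a = - (wt D)%:Z -> lev a = D.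
Proof.
move=> va; rewrite /lev; case: xgetP => [D' _ /= |/(_ D)//].
rewrite va => E; have := wt_ltn D D'; have := wt_ltn D' D.
by case: (ltngtP D' D) => //; lia.
Qed.

Lemma monic_lev a : is_monic oo sgn a -> oo a = - (wt (lev a))%:Z.
Proof. by move=> /monic_deg[D va]; rewrite (levE va). Qed.

Lemma Mo_lev D a : a \in Mo D -> lev a = D.
Proof. by move=> /MoP[_ /levE]. Qed.

Lemma mterm_val a : index a -> w (mterm a) = (\sum_(i < r) s i * wt (lev (a i)))%N%:Z.
Proof.
case=> am _ _; rewrite /mzv_term (valrV wP).
have [|_ ->] := @valr_prod _ _ wP _ (index_enum _) (fun i => j (a i) ^+ s i).
  by move=> i; rewrite expf_neq0 ?fmorph_eq0 //; case: (am i).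
rewrite -sumrN (big_morph Posz PoszD (erefl _)); apply: eq_bigr => i _.
rewrite (valrX wP) wj monic_lev // pmulrn mulrzz; lia.
Qed.

Definition level_fset N : {fset k} := [fset x in flatten [seq Mo D | D <- seq.iota 0 N]]%fset.

Lemma level_fsetP N a : a \in level_fset N <-> is_monic oo sgn a /\ (lev a < N)%N.
Proof.
rewrite in_fset /=; split.
  case/flattenP=> l /mapP[D]; rewrite mem_iota => /andP[_ lt] -> ha.
  by rewrite (Mo_lev ha); split=> //; case/MoP: ha.
move=> [am lt]; apply/flattenP; exists (Mo (lev a)); last by apply/MoP; split=> //; apply: monic_lev.
by apply: map_f; rewrite mem_iota.
Qed.

Section Partial.

Variable N : nat.
Local Notation B := (level_fset N.+1).

Definition descending (d : 'I_r -> nat) := [forall i : 'I_r, forall l : 'I_r, (i < l)%N ==> (d l < d i)%N].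

(** Built from functions into a finite type, so that products of level sums expand by
    distributivity. *)
Definition partial_fset : {fset {ffun 'I_r -> k}} :=
  [fset [ffun i => val (g i)] | g : {ffun 'I_r -> B} in
     [pred g : {ffun 'I_r -> B} | descending (fun i => lev (val (g i)))]]%fset.

Lemma partial_fsetP a : a \in partial_fset <-> index a /\ forall i, (lev (a i) <= N)%N.
Proof.
split.
  case/imfsetP=> g /= /forallP/= gd ->.
  have gP i := (level_fsetP _ _).1 (valP (g i)).
  split; last by move=> i; rewrite ffunE; case: (gP i).
  split=> [i|i l lt|i]; rewrite ?ffunE /pole_order; first by case: (gP i).
    have [m1 _] := gP i; have [m2 _] := gP l.
    rewrite !monic_lev // !opprK ltz_nat wt_ltn.
    by have /forallP/(_ l)/implyP := gd i; apply.
  by have [m1 _] := gP i; rewrite monic_lev // opprK.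
case=> -[am ad _] aN.
have aB i : a i \in B by apply/level_fsetP; split=> //; rewrite ltnS.
apply/imfsetP; exists [ffun i => [` aB i]%fset] => /=.
  apply/forallP => i; apply/forallP => l; apply/implyP => lt; rewrite !ffunE /=.
  by have := ad i l lt; rewrite /pole_order !monic_lev // !opprK ltz_nat wt_ltn.
by apply/ffunP => i; rewrite !ffunE.
Qed.

Lemma sum_level D s' : (D <= N)%N ->
  \sum_(x : B | lev (val x) == D) (val x ^+ s')^-1 = H D s'.
Proof.
move=> le; rewrite -(big_seq_fsetE _ B (fun x => lev x == D) (fun x => (x ^+ s')^-1)) /=.
rewrite -big_filter; apply: perm_big; apply: uniq_perm => //.
  by rewrite filter_uniq ?fset_uniq.
move=> a; rewrite mem_filter; apply/andP/idP => [[/eqP <-]|aM].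
  by move/level_fsetP=> [am _]; apply/MoP; split=> //; apply: monic_lev.
rewrite (Mo_lev aM) eqxx; split=> //; apply/level_fsetP; rewrite (Mo_lev aM) ltnS.
by case/MoP: aM.
Qed.

Lemma sum_partial : \sum_(a <- partial_fset) mterm a =
  \sum_(d : {ffun 'I_r -> 'I_N.+1} | descending (fun i => d i : nat)) j (\prod_(i < r) H (d i) (s i)).
Proof.
rewrite big_imfset /=; last first.
  move=> g g' _ _ /ffunP E; apply/ffunP => i; apply: val_inj.
  by have := E i; rewrite !ffunE.
have levB (x : B) : (lev (val x) < N.+1)%N := ((level_fsetP _ _).1 (valP x)).2.
pose lv (g : {ffun 'I_r -> B}) := [ffun i => Ordinal (levB (g i))].
have lvE g : descending (fun i => lv g i : nat) = descending (fun i => lev (val (g i))).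
  by apply: eq_forallb => i; apply: eq_forallb => l; rewrite !ffunE.
rewrite big_enum_cond /= (eq_bigl (fun g => descending (fun i => lv g i : nat))); last first.
  by move=> g; rewrite lvE andbT.
rewrite (partition_big lv (fun d => descending (fun i => d i : nat))) //=.
apply: eq_bigr => d dP.
under [X in _ = j X]eq_bigr => i _ do rewrite -(sum_level _ (ltn_ord (d i))).
rewrite bigA_distr_big_dep rmorph_sum; apply: eq_big => [g|g _].
  apply/andP/familyP => [[_ /eqP <-] i|h]; first by rewrite unfold_in ffunE.
  have E : lv g = d.
    by apply/ffunP => i; apply: ord_inj; rewrite ffunE; have := h i; rewrite unfold_in => /eqP.
  by rewrite E.
rewrite /mzv_term -prodfV rmorph_prod; apply: eq_bigr => i _.
by rewrite !ffunE fmorphV rmorphXn.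
Qed.

End Partial.

Lemma H_ltn s' D D' : (0 < s')%N -> (D < D')%N -> oo (H D s') < oo (H D' s').
Proof.
move=> s0; exact: (@homo_ltn _ (fun D => oo (H D s')) (fun x y => x < y)
  (fun y x z => @lt_trans _ _ y x z) (fun D => H_lt D s0)).
Qed.

Lemma descending_ge (d : 'I_r -> nat) (i : 'I_r) : descending d -> (r - i.+1 <= d i)%N.
Proof.
move=> dP; have [m Em] : exists m, (r - i.+1)%N = m by eexists.
elim: m i Em => [|m IHm] i Em; first by rewrite Em.
have lt : (i.+1 < r)%N by lia.
have Em' : (r - (Ordinal lt).+1)%N = m by rewrite /=; lia.
have := IHm _ Em'; rewrite Em' Em => h.
have /forallP/(_ i)/forallP/(_ (Ordinal lt))/implyP/(_ (ltnSn i)) := dP.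
exact: leq_ltn_trans.
Qed.

(** A descending [d] satisfies [d i >= r - i.+1], with equality throughout only for [d0]; by [H_ltn]
    the product for [d0] strictly dominates. *)
Lemma val_partial N : (r <= N.+1)%N ->
  \sum_(a <- partial_fset N) mterm a != 0 /\
  w (\sum_(a <- partial_fset N) mterm a) = \sum_(i < r) oo (H (r - i.+1) (s i)).
Proof.
move=> leN; pose d0 : {ffun 'I_r -> 'I_N.+1} := [ffun i : 'I_r => inord (r - i.+1)].
have d0E i : d0 i = (r - i.+1)%N :> nat by rewrite ffunE inordK //; lia.
have prodP (d : {ffun 'I_r -> 'I_N.+1}) := @valr_prod _ _ vP _ (index_enum _) (fun i => H (d i) (s i)) (fun i => H_neq0 (d i) (s_gt0 i)).
rewrite sum_partial -rmorph_sum fmorph_eq0 wj -big_filter.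
have -> : \sum_(i < r) oo (H (r - i.+1) (s i)) = oo (\prod_(i < r) H (d0 i) (s i)).
  by rewrite (prodP d0).2; apply: eq_bigr => i _; rewrite d0E.
apply: (val_sum_dominant vP); first by rewrite filter_uniq // index_enum_uniq.
- rewrite mem_filter mem_index_enum andbT; apply/forallP => i; apply/forallP => l.
  by apply/implyP => lt; rewrite !d0E; have := ltn_ord l; lia.
- exact: (prodP d0).1.
move=> d; rewrite mem_filter => /andP[dP _] ne; right.
rewrite lezD1 (prodP d).2 (prodP d0).2.
have le i : oo (H (d0 i) (s i)) <= oo (H (d i) (s i)) ?= iff (d0 i == d i).
  have := descending_ge i dP; rewrite -d0E; case: eqVneq => [->|ne'] le; first by split; rewrite ?eqxx.
  have lt : (d0 i < d i)%N by rewrite ltn_neqAle le andbT.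
  by have h := H_ltn (s_gt0 i) lt; split; [apply: ltW | apply: lt_eqF].
rewrite (lt_leif (leif_sum (fun i _ => le i))).
apply/negP=> /forallP h; case/eqP: ne; apply/ffunP => i; exact/esym/eqP/h.
Qed.

Lemma sum_fset_diff (S T : {fset {ffun 'I_r -> k}}) N : (S `<=` T)%fset ->
  (forall a, a \in T -> a \notin S -> val_ge w N (mterm a)) ->
  val_ge w N (\sum_(a <- T) mterm a - \sum_(a <- S) mterm a).
Proof.
move=> ST h; rewrite (bigID (mem S)) /=.
have -> : \sum_(a <- T | a \in S) mterm a = \sum_(a <- S) mterm a.
  rewrite -big_filter; apply: perm_big; apply: uniq_perm; rewrite ?filter_uniq ?fset_uniq //.
  by move=> a; rewrite mem_filter; apply: andb_idr; move/fsubsetP: ST; apply.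
rewrite addrAC subrr add0r; apply: (val_ge_sum wP) => a aT aS; exact: h.
Qed.

(** Some entry has level above [N]; its contribution to the valuation exceeds [N], and the others
    are nonnegative. *)
Lemma mterm_tail N a : index a -> a \notin partial_fset N -> val_ge w N.+1%:Z (mterm a).
Proof.
move=> Ia /negP aS; right; rewrite mterm_val // lez_nat.
have [i lt] : exists i, (N < lev (a i))%N.
  apply: contrapT => h; apply: aS; apply/partial_fsetP; split=> // i.
  by rewrite leqNgt; apply/negP => lt; apply: h; exists i.
rewrite (bigD1 i) //=; apply: leq_trans (leq_addr _ _).
apply: leq_trans lt _; apply: leq_trans (wt_ge _) _.
by rewrite leq_pmull.
Qed.

Lemma partial_fset_index N a : a \in partial_fset N -> index a.
Proof. by move/partial_fsetP=> []. Qed.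

Lemma partial_fset_sub N N' : (N <= N')%N -> (partial_fset N `<=` partial_fset N')%fset.
Proof.
move=> le; apply/fsubsetP => a /partial_fsetP[Ia aN]; apply/partial_fsetP; split=> // i.
exact: leq_trans (aN i) le.
Qed.

(** The sums over [partial_fset N] form a Cauchy sequence by [mterm_tail]. Existence rules out the
    default value of [mzv]. *)
Lemma mzv_exists : exists z, has_sum w index mterm z.
Proof.
have [_ _ _ complete] := hK.
have [n|z hz] := complete (fun N => \sum_(a <- partial_fset N) mterm a).
  exists `|n|%N => N N' le le'.
  wlog leNN : N N' le le' / (N' <= N)%N.
    move=> h; case: (leqP N' N) => [|/ltnW] hNN; first exact: h.
    by rewrite -opprB; apply: (val_geN wP); apply: h.
  apply: sum_fset_diff; first exact: partial_fset_sub.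
  move=> a /partial_fset_index Ia /(mterm_tail Ia); apply: val_ge_le; lia.
exists z => n; have [N hN] := hz n; pose N' := maxn N `|n|%N.
exists (partial_fset N'); split=> [a /partial_fset_index //|S SI sub].
rewrite -[_ - z](subrKA (\sum_(a <- partial_fset N') mterm a)); apply: (val_geD wP).
  apply: sum_fset_diff => // a /SI Ia /(mterm_tail Ia); apply: val_ge_le.
  by have := leq_maxr N `|n|%N; rewrite -/N'; lia.
by apply: hN; apply: leq_maxl.
Qed.

(** If [z = 0], the sum over [S0] and a large partial set has valuation above [c]; the terms outside
    the partial set do too, but the partial sum has valuation exactly [c]. *)
Lemma mzv_neq0 z : has_sum w index mterm z -> z != 0.
Proof.
pose c := \sum_(i < r) oo (H (r - i.+1) (s i)).
move=> /(_ (c + 1)) [S0 [S0I hS]]; apply/eqP => z0.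
pose N := maxn r `|(c + 1)%R|%N.
have [u0 uc] := @val_partial N (leqW (leq_maxl _ _)).
have h1 : val_ge w (c + 1) (\sum_(a <- (S0 `|` partial_fset N)%fset) mterm a).
  have := hS (S0 `|` partial_fset N)%fset; rewrite z0 subr0; apply; last exact: fsubsetUl.
  by move=> a; rewrite in_fsetU => /orP[/S0I|/partial_fset_index].
have h2 : val_ge w (c + 1) (\sum_(a <- (S0 `|` partial_fset N)%fset) mterm a
    - \sum_(a <- partial_fset N) mterm a).
  apply: sum_fset_diff => [|a]; first exact: fsubsetUr.
  rewrite in_fsetU => /orP[/S0I Ia|-> //] /(mterm_tail Ia); apply: val_ge_le.
  by have := leq_maxr r `|(c + 1)%R|%N; rewrite -/N; lia.
have := val_geB wP h1 h2; rewrite subKr => /(val_geW u0).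
by rewrite uc -/c gerDl.
Qed.

End MultipleZeta.

Theorem corollary1p3
  (F : finFieldType) (k : fieldType) (iota : {rmorphism F -> k})
  (hk : is_function_field iota) (hg : has_genus iota 1)
  (oo : place iota) (hoo : place_degree oo = 1%N)
  (sgn : k -> F) (hsgn : is_sign oo sgn)
  (K : fieldType) (j : {rmorphism k -> K}) (w : K -> int)
  (hK : is_completion oo j w)
  (r : nat) (hr : (1 <= r)%N) (s : 'I_r -> nat)
  (hs : forall i : 'I_r, (0 < s i)%N) :
  mzv oo sgn j w s != 0.
Proof.
have [p p_pr pF] := finPcharP F.
have [e cardF] := card_pchar_pow pF.
have [X [wt [Xm vX [wt_lt wt0 wtS] degs XP]]] := monic_basis hk hg hoo hsgn.
pose Mo D := [seq X D + b | b <- lins iota X D].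
have X0 i : X i != 0 by case: (Xm i).
have Mo_uniq D : uniq (Mo D) by rewrite (map_inj_uniq (addrI _)); exact: (XP D).1.
have MoP D a : is_monic oo sgn a /\ oo a = - (wt D)%:Z <-> a \in Mo D.
  rewrite (XP D).2; split=> [h|/mapP[b hb ->]]; last by rewrite addrC addKr.
  by apply/mapP; exists (a - X D); rewrite // addrC subrK.
have HP t D (t0 : (0 < t)%N) : \sum_(a <- Mo D) (a ^+ t)^-1 != 0 /\
    oo (\sum_(a <- Mo D) (a ^+ t)^-1) < oo (\sum_(a <- Mo D.+1) (a ^+ t)^-1).
  have [h1 _ h2] := val_power_sum_lt pF cardF (pval_valuation oo) (@pval_const _ _ _ oo)
    X0 vX wt_lt wt0 wtS t0 D.
  by rewrite !big_map.
have H0 t D t0 := (HP t D t0).1; have Hlt t D t0 := (HP t D t0).2.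
rewrite /mzv; case: xgetP => [z _ hz|none].
  exact: (mzv_neq0 hK wt_lt Mo_uniq MoP degs H0 Hlt hs hz).
have [z hz] := mzv_exists hK wt_lt MoP degs hs.
by case: (none z).
Qed.
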